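(* Let $G$ be a countable directed graph and let $w\in FP(G)$. Then the $D_G$-valued random variables $L_w$ and $L_w^*$ in $(W^*(G),E)$ are $D_G$-valued R-diagonal.
   Context: $G$ is a countable directed graph with vertex set $V(G)$ and edge set $E(G)$. $FP(G)$ is the set of all admissible finite paths (of length at least $1$; edges are the paths of length $1$), and $\mathbb{F}^+(G)=V(G)\cup FP(G)$ is the free semigroupoid of $G$, with vertices as units. Writing $w=xwy$ means that $w$ has source $x\in V(G)$ and range $y\in V(G)$; for a vertex, $v=vvv$. $H_G=\ell^2(\mathbb{F}^+(G))$ has orthonormal basis $\{\xi_w:w\in\mathbb{F}^+(G)\}$. For $w\in\mathbb{F}^+(G)$, $L_w\xi_{w'}=\xi_{ww'}$ if $ww'\in\mathbb{F}^+(G)$ and $0$ otherwise, and $L_w^*\xi_{w'}=\xi_h$ if $w'=wh\in\mathbb{F}^+(G)$ and $0$ otherwise. The graph $W^*$-algebra $W^*(G)$ is the weak closure of $\mathbb{C}[\{L_w,L_w^*:w\in\mathbb{F}^+(G)\}]$ and the diagonal subalgebra $D_G$ is the von Neumann subalgebra generated by $\{L_v:v\in V(G)\}$. The paper evaluates products using $L_w^*L_w=L_y$ and $L_wL_w^*=L_x$ for $w=xwy$ (stated as relations holding under the weak topology). Every $a\in W^*(G)$ is written in its Fourier expansion $a=\sum_{w\in\mathbb{F}^+(G:a),\,u_w\in\{1,*\}}p_wL_w^{u_w}$ with support $\mathbb{F}^+(G:a)=\{w:p_w\neq0\}$, and $V(G:a)=V(G)\cap\mathbb{F}^+(G:a)$.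 The conditional expectation $E:W^*(G)\to D_G$ is $E(a)=\sum_{v\in V(G:a)}p_vL_v$. $D_G$-valued cumulants (Speicher): $k_n(a_1,\dots,a_n)=\sum_{\pi\in NC(n)}\widehat{E}(\pi)(a_1\otimes\cdots\otimes a_n)\,\mu(\pi,1_n)$, where $NC(n)$ is the lattice of noncrossing partitions of $\{1,\dots,n\}$ with maximal element $1_n$, $\mu$ is its Möbius function and $\widehat{E}$ is the moment multiplicative bimodule map induced by $E$. R-diagonality: a $D_G$-valued random variable $x$ is $D_G$-valued R-diagonal if the only nonvanishing mixed $D_G$-valued cumulants of $x$ and $x^*$ are the alternating ones of even order, $k_n(b_1x,b_2x^*,\dots,b_{n-1}x,b_nx^* )$ and $k_n(b_1'x^*,b_2'x,\dots,b_{n-1}'x^*,b_n'x)$, for $n\in2\mathbb{N}$ and arbitrary $b_1,b_1',\dots,b_n,b_n'\in D_G$ (so all other mixed cumulants of $x$ and $x^*$, in particular those of odd order, vanish). *)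

(* Defs.v *)
From HB Require Import structures.
From mathcomp Require Import all_boot all_order all_algebra.

Set Implicit Arguments.
Unset Strict Implicit.
Unset Printing Implicit Defensive.

Import Order.TTheory GRing.Theory Num.Theory.

Local Open Scope ring_scope.

(** * Noncrossing partitions and the Moebius function *)

Definition noncrossing n (P : {set {set 'I_n}}) : bool :=
  partition P [set: 'I_n] &&
  [forall B in P, forall C in P, (B != C) ==>
    [forall i in B, forall j in C, forall k in B, forall l in C,
      ~~ [&& (i < j)%N, (j < k)%N & (k < l)%N]]].

Definition nc_le n (P Q : {set {set 'I_n}}) : bool :=
  [&& noncrossing P, noncrossing Q &
      [forall B in P, exists C in Q, B \subset C]].

(* mu(x,x) = 1 and mu(x,y) = - sum_{x <= z < y} mu(x,z) if x < y.  The fuel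
   [#|T|] exceeds the length of every strict chain. *)
Fixpoint mobius_rec (T : finType) (le : rel T) (k : nat) (x y : T) : int :=
  if k is k'.+1 then
    if x == y then 1
    else if le x y then
      - \sum_(z | [&& le x z, le z y & z != y]) mobius_rec le k' x z
    else 0
  else 0.

Definition mobius (T : finType) (le : rel T) (x y : T) : int :=
  mobius_rec le #|T| x y.

(** * Operator-valued moments and cumulants *)

Section Cumulants.
Variables (A : pzRingType) (E : A -> A).

(* Cuts t = g_1 (c,a_1) g_2 (c,a_2) ... g_m (c,a_m) r, with no label c in the
   g_i and in r, into ([:: (g_1,a_1); ...; (g_m,a_m)], r). *)
Fixpoint chop (L : eqType) (c : L) (t : seq (L * A)) :
    seq (seq (L * A) * A) * seq (L * A) :=
  if t is (c', a) :: t' then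
    let: (ps, r) := chop c t' in
    if c' == c then (([::], a) :: ps, r)
    else if ps is (g, a1) :: ps' then (((c', a) :: g, a1) :: ps', r)
    else ([::], (c', a) :: r)
  else ([::], [::]).

(* Nested moment of a word whose letters are labelled by their block: if
   a_{j_1}, ..., a_{j_m} is the block of the first letter, the value is
     E(a_{j_1} M_1 a_{j_2} M_2 ... M_{m-1} a_{j_m}) M',
   where M_i is the nested moment of the letters strictly between j_i and
   j_{i+1}, and M' that of the letters after j_m.  The fuel is the length. *)
Fixpoint nested_moment (L : eqType) (k : nat) (s : seq (L * A)) : A :=
  if k is k'.+1 then
    if s is (c, a) :: t then
      let: (ps, r) := chop c t in
      E (a * \prod_(p <- ps) (nested_moment k' p.1 * p.2)) * nested_moment k' r
    else 1
  else 1.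

Definition hatE n (P : {set {set 'I_n}}) (a : 'I_n -> A) : A :=
  nested_moment n [seq (pblock P i, a i) | i <- enum 'I_n].

Definition cumulant n (a : 'I_n -> A) : A :=
  \sum_(P : {set {set 'I_n}} | noncrossing P)
    hatE P a *~ mobius (@nc_le n) P [set [set: 'I_n]].

End Cumulants.

(* [true] stands for x and [false] for its adjoint. *)
Definition alternating_even n (eps : 'I_n -> bool) : Prop :=
  ~~ odd n /\ forall i j : 'I_n, j = i.+1 :> nat -> eps j != eps i.

(* x, with adjoint xs, is an R-diagonal element of the D-valued probability
   space (W, E): every cumulant of x and xs of order at least 1 that is not
   alternating of even order vanishes. *)
Definition R_diagonal (A : pzRingType) (W D : A -> Prop) (E : A -> A)
    (x xs : A) : Prop :=
  [/\ W x, W xs &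
    forall n (eps : 'I_n -> bool) (b : 'I_n -> A),
      (0 < n)%N -> (forall i, D (b i)) -> ~ alternating_even eps ->
      cumulant E (fun i => b i * (if eps i then x else xs)) = 0].


From mathcomp Require Import complex.
From mathcomp Require Import boolp classical_sets functions cardinality fsbigop.
From mathcomp Require Import reals ereal.
From mathcomp Require Import topology normedtype sequences esum.
From mathcomp Require Import ring lra.

Import numFieldNormedType.Exports.
Local Open Scope classical_set_scope.

(** * The Hilbert space l2(X) and its bounded operators *)

Definition abs2 (R : realType) (z : R[i]) : R := complex.Re z ^+ 2 + complex.Im z ^+ 2.

Definition sqnorm (R : realType) (X : choiceType) (f : X -> R[i]) : \bar R :=
  \esum_(x in [set: X]) (abs2 (f x))%:E.

Section L2.
Variables (R : realType) (X : countType).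
Local Notation C := R[i].

Lemma abs2_ge0 (z : C) : 0 <= abs2 z.
Proof. by rewrite addr_ge0 ?sqr_ge0. Qed.

Lemma abs2E0 : abs2 (0 : C) = 0.
Proof. by rewrite /abs2 /= expr0n addr0. Qed.

Lemma abs2M (y z : C) : abs2 (y * z) = abs2 y * abs2 z.
Proof. by case: y => a b; case: z => c d; rewrite /abs2 /=; ring. Qed.

Lemma abs2D (y z : C) : abs2 (y + z) <= 2 * (abs2 y + abs2 z).
Proof.
case: y => a b; case: z => c d; rewrite /abs2 /= -subr_ge0.
rewrite (_ : _ - _ = (a - c) ^+ 2 + (b - d) ^+ 2); last by ring.
by rewrite addr_ge0 ?sqr_ge0.
Qed.

Lemma sqnorm_ge0 (f : X -> C) : (0 <= sqnorm f)%E.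
Proof. by apply: esum_ge0 => x _; rewrite lee_fin abs2_ge0. Qed.

Lemma abs2_sqnorm (f : X -> C) x : ((abs2 (f x))%:E <= sqnorm f)%E.
Proof.
apply: esum_ge; exists [set x]; first by split=> //; exact: finite_set1.
by rewrite fsbig_set1.
Qed.

Lemma sqnormZ (M : R) (f : X -> C) : 0 <= M ->
  (\esum_(x in [set: X]) (M * abs2 (f x))%:E <= M%:E * sqnorm f)%E.
Proof.
move=> M0; apply: ge_ereal_sup => _ [F FX <-].
under eq_fsbigr do rewrite EFinM.
rewrite -ge0_mule_fsumr; last by move=> x; rewrite lee_fin abs2_ge0.
apply: lee_wpmul2l; first by rewrite lee_fin.
by apply: esum_ge; exists F.
Qed.

Lemma sqnorm_mull (d f : X -> C) (M : R) : 0 <= M ->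
  (forall x, abs2 (d x) <= M) ->
  (sqnorm (fun x => (d x * f x)%R) <= M%:E * sqnorm f)%E.
Proof.
move=> M0 dM; apply: le_trans (sqnormZ f M0).
apply: le_esum => x _; rewrite lee_fin abs2M.
by rewrite ler_wpM2r ?abs2_ge0.
Qed.

Lemma sqnormD (f g : X -> C) :
  (sqnorm (f \+ g)%R <= 2%:E * (sqnorm f + sqnorm g))%E.
Proof.
rewrite ge0_muleDr ?sqnorm_ge0 //.
apply: (@le_trans _ _ (\esum_(x in [set: X]) (2 * abs2 (f x))%:E +
                       \esum_(x in [set: X]) (2 * abs2 (g x))%:E)%E).
  rewrite -esumD; try by move=> x _; rewrite lee_fin mulr_ge0 ?abs2_ge0.
  by apply: le_esum => x _; rewrite -EFinD lee_fin -mulrDr abs2D.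
by apply: leeD; apply: sqnormZ.
Qed.

Definition l2_pred : {pred X -> C} := fun f => (sqnorm f < +oo)%E.

Lemma l2_submod_closed : submod_closed l2_pred.
Proof.
split=> [|c f g].
  rewrite unfold_in /l2_pred /= /sqnorm esum1 ?ltry // => x _.
  by rewrite /= abs2E0.
rewrite !unfold_in /l2_pred => lf lg.
apply: le_lt_trans (sqnormD _ _) _; rewrite lte_mul_pinfty //.
apply: lte_add_pinfty => //.
apply: (le_lt_trans (@sqnorm_mull (cst c) f (abs2 c) (abs2_ge0 _) _)) => //.
by rewrite lte_mul_pinfty // lee_fin abs2_ge0.
Qed.

HB.instance Definition _ :=
  GRing.isSubmodClosed.Build C (X -> C) l2_pred l2_submod_closed.

Record l2 := L2 { l2_fun :> X -> C; l2_funP : l2_fun \in l2_pred }.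

HB.instance Definition _ := [isSub for l2_fun].
HB.instance Definition _ := [Choice of l2 by <:].
HB.instance Definition _ := [SubChoice_isSubLmodule of l2 by <:].

(* The sum runs over X along its canonical enumeration; it is absolutely
   convergent for f, g in l2(X). *)
Definition inner (f g : l2) : C :=
  let t k := oapp (fun x => f x * conjc (g x)) 0 (pickle_inv k) in
  Complex (limn (fun N => \sum_(0 <= k < N) complex.Re (t k)))
          (limn (fun N => \sum_(0 <= k < N) complex.Im (t k))).

Definition bounded_linear : {pred l2 -> l2} := fun T =>
  `[< linear T /\
      exists2 M : R, 0 <= M & forall f, (sqnorm (T f) <= M%:E * sqnorm f)%E >].

Record bop := Bop { bop_fun :> l2 -> l2; bop_funP : bop_fun \in bounded_linear }.

Lemma bounded_linear_submod_closed : submod_closed bounded_linear.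
Proof.
split=> [|c S T].
  apply/asboolP; split=> [a u v|]; first by rewrite /= scaler0 addr0.
  exists 0 => // f; rewrite mul0e /= /sqnorm esum1 // => x _.
  by rewrite /= abs2E0.
move=> /asboolP[linS [M M0 SM]] /asboolP[linT [N N0 TN]]; apply/asboolP; split.
  move=> a u v.
  change (c *: S (a *: u + v) + T (a *: u + v) =
          a *: (c *: S u + T u) + (c *: S v + T v)).
  rewrite linS linT !scalerDr !scalerA addrACA; congr (_ + _ + _).
  by rewrite [a * c]mulrC.
exists (2 * (abs2 c * M + N)) => [|f].
  by rewrite mulr_ge0 // addr_ge0 // mulr_ge0 // abs2_ge0.
apply: le_trans (sqnormD _ _) _; rewrite EFinM -muleA.
apply: lee_wpmul2l => //.
rewrite EFinD ge0_muleDl ?lee_fin ?mulr_ge0 ?abs2_ge0 //.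
apply: leeD => //.
apply: (le_trans (@sqnorm_mull (cst c) (S f) (abs2 c) (abs2_ge0 _) _)) => //.
by rewrite EFinM -muleA; apply: lee_wpmul2l; rewrite ?lee_fin ?abs2_ge0.
Qed.

HB.instance Definition _ :=
  GRing.isSubmodClosed.Build C (l2 -> l2) bounded_linear
    bounded_linear_submod_closed.
HB.instance Definition _ := [isSub for bop_fun].
HB.instance Definition _ := [Choice of bop by <:].
HB.instance Definition _ := [SubChoice_isSubLmodule of bop by <:].

Lemma id_bounded_linear : (id : l2 -> l2) \in bounded_linear.
Proof. by apply/asboolP; split=> //; exists 1 => // f; rewrite mul1e. Qed.

Lemma comp_bounded_linear (S T : bop) : (S \o T) \in bounded_linear.
Proof.
case: S T => S /= /asboolP[linS [M M0 SM]] [T /= /asboolP[linT [N N0 TN]]].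
apply/asboolP; split=> [a u v|]; first by rewrite /= linT linS.
exists (M * N) => [|f]; first exact: mulr_ge0.
apply: le_trans (SM _) _; rewrite EFinM -muleA.
exact: lee_wpmul2l.
Qed.

Definition bop1 : bop := Bop id_bounded_linear.
Definition bopM (S T : bop) : bop := Bop (comp_bounded_linear S T).

Lemma bopP (S T : bop) : (forall f x, S f x = T f x) -> S = T.
Proof.
move=> ST; apply/val_inj/funext => f; apply/val_inj/funext => x; exact: ST.
Qed.

Lemma bop_linear (T : bop) : linear T.
Proof. by case: T => T /= /asboolP[]. Qed.

Lemma bopMA : associative bopM. Proof. by move=> S T U; apply: bopP. Qed.
Lemma bop1M : left_id bop1 bopM. Proof. by move=> T; apply: bopP. Qed.
Lemma bopM1 : right_id bop1 bopM. Proof. by move=> T; apply: bopP. Qed.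
Lemma bopMDl : left_distributive bopM +%R.
Proof. by move=> S T U; apply: bopP. Qed.
Lemma bopMDr : right_distributive bopM +%R.
Proof.
move=> S T U; apply: bopP => f x /=.
by have := bop_linear S 1 (T f) (U f); rewrite !scale1r => ->.
Qed.

HB.instance Definition _ :=
  GRing.Zmodule_isPzRing.Build bop bopMA bop1M bopM1 bopMDl bopMDr.

(* Closure in the weak operator topology. *)
Definition wot_closure (S : set bop) : set bop := [set T |
  forall (s : seq (l2 * l2)) (e : R), 0 < e ->
  exists2 T0, S T0 &
    forall p, p \in s -> ComplexField.Normc.normc (inner ((T - T0) p.1) p.2) < e].

(* Smallest set containing [gens] and closed under sums, products and scalar
   multiples; a *-algebra when [gens] is closed under adjoints. *)
Inductive generated_algebra (gens : set bop) : set bop :=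
| Gen_0 : generated_algebra gens 0
| Gen_in T : gens T -> generated_algebra gens T
| Gen_add S T : generated_algebra gens S -> generated_algebra gens T ->
    generated_algebra gens (S + T)
| Gen_scale c T : generated_algebra gens T -> generated_algebra gens (c *: T)
| Gen_mul S T : generated_algebra gens S -> generated_algebra gens T ->
    generated_algebra gens (S * T).

(* Conditional expectation of W onto D, in the algebraic sense. *)
Definition conditional_expectation (W D : set bop) (E : bop -> bop) : Prop :=
  [/\ forall T, W T -> D (E T),
      forall d, D d -> E d = d,
      forall c S T, W S -> W T -> E (c *: S + T) = c *: E S + E T &
      forall d T d', D d -> W T -> D d' -> E (d * T * d') = d * E T * d'].

(** ** Two families of operators *)

Definition partial_injection (p : X -> option X) : Prop :=
  forall x y z, p x = Some z -> p y = Some z -> x = y.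

Lemma sqnorm_pull (p : X -> option X) (f : X -> C) : partial_injection p ->
  (sqnorm (fun x => oapp f 0%R (p x)) <= sqnorm f)%E.
Proof.
move=> pI; pose P : set X := [set x | p x].
pose e x := odflt x (p x).
have eI : {in P &, injective e}.
  move=> x y; rewrite !inE /P /= /e.
  case px : (p x) => [z|] // _; case py : (p y) => [t|] //= _ zt.
  by apply: (pI x y z); rewrite // py zt.
rewrite [leRHS]/sqnorm.
apply: (@le_trans _ _ (\esum_(x in e @` P) (abs2 (f x))%:E)%E); last first.
  rewrite esum_mkcond; apply: le_esum => x _; case: ifP => // _.
  by rewrite lee_fin abs2_ge0.
rewrite (reindex_esum P (e @` P) e) //; last exact: inj_bij.
rewrite [leRHS]esum_mkcond; apply: le_esum => x _.
rewrite /e; case: ifPn => [|]; rewrite ?inE ?notin_setE /P /=.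
  by case: (p x).
by case: (p x) => [z /(_ isT)|] //= _; rewrite abs2E0.
Qed.

Definition pull_fun (p : X -> option X) (pI : partial_injection p) (f : l2) : l2.
Proof.
exists (fun x => oapp f 0 (p x)).
exact: le_lt_trans (sqnorm_pull f pI) (l2_funP f).
Defined.

Lemma pull_subproof p (pI : partial_injection p) :
  pull_fun pI \in bounded_linear.
Proof.
apply/asboolP; split=> [a u v|].
  apply/val_inj/funext => x.
  change (oapp (a *: u + v) 0 (p x) = a * oapp u 0 (p x) + oapp v 0 (p x)).
  by case: (p x) => //=; rewrite mulr0 addr0.
by exists 1 => // f; rewrite mul1e; exact: sqnorm_pull.
Qed.

(* (pull p f)(x) = f(p(x)), or 0 where p is undefined. *)
Definition pull p (pI : partial_injection p) : bop := Bop (pull_subproof pI).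

Definition bounded_coef (d : X -> C) : Prop :=
  exists2 M : R, 0 <= M & forall x, abs2 (d x) <= M.

Definition diag_fun (d : X -> C) (dB : bounded_coef d) (f : l2) : l2.
Proof.
exists (fun x => d x * f x); case: dB => M M0 dM.
apply: le_lt_trans (sqnorm_mull f M0 dM) _.
by rewrite lte_mul_pinfty //; exact: (l2_funP f).
Defined.

Lemma diag_subproof d (dB : bounded_coef d) : diag_fun dB \in bounded_linear.
Proof.
apply/asboolP; split=> [a u v|].
  apply/val_inj/funext => x.
  change (d x * (a * u x + v x) = a * (d x * u x) + d x * v x).
  by rewrite mulrDr mulrCA.
by case: (dB) => M M0 dM; exists M => // f; exact: sqnorm_mull.
Qed.

Definition diag d (dB : bounded_coef d) : bop := Bop (diag_subproof dB).

Lemma sqnorm_delta (x : X) : sqnorm (fun y => (y == x)%:R : C) = 1%E.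
Proof.
rewrite /sqnorm (_ : 1%E = \esum_(y in [set x]) (1%:E : \bar R))%E; last first.
  by rewrite esum_set1 // lee_fin.
rewrite [RHS]esum_mkcond; apply: eq_esum => y _.
have [->|yx] := eqVneq y x.
  by rewrite ifT ?inE // /abs2 /= expr1n expr0n addr0.
rewrite ifF; last by apply/negbTE; rewrite notin_setE /=; exact/eqP.
by rewrite /abs2 /= expr0n addr0.
Qed.

Definition xi (x : X) : l2.
Proof.
exists (fun y => (y == x)%:R).
by rewrite unfold_in /l2_pred sqnorm_delta ltry.
Defined.

End L2.

Arguments xi {R X} x.

(** * Directed graphs and the free semigroupoid *)

Record digraph := Digraph {
  vertex : countType;
  edge : countType;
  src : edge -> vertex;
  tgt : edge -> vertex
}.

Section FreeSemigroupoid.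
Variable G : digraph.

Fixpoint admissible (v : vertex G) (s : seq (edge G)) : bool :=
  if s is e :: s' then (src e == v) && admissible (tgt e) s' else true.

(* (v, [:: e_1; ...; e_n]) is the path e_1 ... e_n with source v; the vertex v
   itself is (v, [::]). *)
Definition fsgd := {w : vertex G * seq (edge G) | admissible w.1 w.2}.
HB.instance Definition _ := Countable.on fsgd.

Definition source (w : fsgd) : vertex G := (val w).1.
Definition edges (w : fsgd) : seq (edge G) := (val w).2.
Definition target (w : fsgd) : vertex G :=
  last (source w) [seq tgt e | e <- edges w].
Definition vtx (v : vertex G) : fsgd := exist _ (v, [::]) isT.

(* FP(G) *)
Definition is_path (w : fsgd) : bool := edges w != [::].

(* The product w w', when it is admissible. *)
Definition concat (w w' : fsgd) : option fsgd :=
  if target w == source w'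
  then (insub (source w, edges w ++ edges w') : option fsgd) else None.

(* The h such that u = w h, when there is one. *)
Definition ldiv (w u : fsgd) : option fsgd :=
  if (source w == source u) && prefix (edges w) (edges u)
  then (insub (target w, drop (size (edges w)) (edges u)) : option fsgd)
  else None.

Lemma admissible_cat v s t : admissible v (s ++ t) =
  admissible v s && admissible (last v [seq tgt e | e <- s]) t.
Proof. by elim: s v => //= e s IHs v; rewrite IHs andbA. Qed.

Lemma insub_fsgd (p : vertex G * seq (edge G)) (w : fsgd) :
  insub p = Some w <-> val w = p.
Proof.
split=> [|<-]; last exact: valK.
by case: insubP => // w' _ <- [->].
Qed.

Lemma ldivP w u h : (ldiv w u = Some h) <-> (concat w h = Some u).
Proof.
rewrite /ldiv /concat; split.
  case: andP => // -[/eqP wu /prefixP[q tE]] /insub_fsgd hE.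
  rewrite {1}/source hE /= eqxx; apply/insub_fsgd.
  rewrite /edges hE tE drop_size_cat // wu -tE.
  by rewrite /source /edges; case: (val u).
case: eqP => // wh /insub_fsgd uE.
rewrite /source /edges uE /= eqxx prefix_prefix /=.
apply/insub_fsgd; rewrite drop_size_cat // wh.
by rewrite /source /edges; case: (val h).
Qed.

Lemma concatI w : partial_injection (concat w).
Proof.
move=> h h' u /ldivP hE /ldivP; by rewrite hE => -[].
Qed.

Lemma ldivI w : partial_injection (ldiv w).
Proof.
move=> u u' h /ldivP hE /ldivP; by rewrite hE => -[].
Qed.

End FreeSemigroupoid.

(** * The graph W*-probability space *)

Section GraphAlgebra.
Variables (R : realType) (G : digraph).
Local Notation B := (bop R (fsgd G)).

(* (L_w f)(u) = f(h) if u = w h, and 0 if u is not of this form;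
   (L_w^* f)(h) = f(w h), and 0 if w h is not admissible. *)
Definition L (w : fsgd G) : B := pull R (ldivI (w := w)).
Definition Lstar (w : fsgd G) : B := pull R (concatI (w := w)).

Lemma L_xi w h : L w (xi h) = oapp xi 0 (concat w h).
Proof.
apply/val_inj/funext => u /=.
case uE : (concat w h) => [t|] /=.
  have [->|ut] := eqVneq u t.
    by rewrite (proj2 (ldivP _ _ _) uE) /= eqxx.
  case hE : (ldiv w u) => [h'|] //=.
  have [hh'|//] := eqVneq; move/ldivP: hE; rewrite hh' uE => -[tu].
  by rewrite tu eqxx in ut.
case hE : (ldiv w u) => [h'|] //=.
have [hh'|//] := eqVneq; by move/ldivP: hE; rewrite hh' uE.
Qed.

Lemma Lstar_xi w u : Lstar w (xi u) = oapp xi 0 (ldiv w u).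
Proof.
apply/val_inj/funext => h /=.
case hE : (ldiv w u) => [t|] /=.
  have [->|ht] := eqVneq h t.
    by rewrite (proj1 (ldivP _ _ _) hE) /= eqxx.
  case uE : (concat w h) => [u'|] //=.
  have [uu'|//] := eqVneq; move/ldivP: uE; rewrite uu' hE => -[tu].
  by rewrite tu eqxx in ht.
case uE : (concat w h) => [u'|] //=.
have [uu'|//] := eqVneq; by move/ldivP: uE; rewrite uu' hE.
Qed.

Definition Wstar : set B :=
  wot_closure (generated_algebra [set T | exists w, T = L w \/ T = Lstar w]).

Definition DG : set B :=
  wot_closure (generated_algebra [set T | exists v, T = L (vtx v)]).

(* The Fourier coefficient p_v of T at a vertex v, i.e. the coefficient of
   xi_v in T xi_v. *)
Definition vcoef (T : B) (v : vertex G) : R[i] := T (xi (vtx v)) (vtx v).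

Lemma vcoef_bounded T : bounded_coef (fun u => vcoef T (source u)).
Proof.
have /asboolP[_ [M M0 TM]] := bop_funP T; exists M => // u.
rewrite -lee_fin; apply: (le_trans (abs2_sqnorm (T (xi (vtx (source u)))) _)).
by apply: (le_trans (TM _)); rewrite sqnorm_delta mule1.
Qed.

(* The expectation read off from Fourier coefficients, E(T) = sum_v p_v L_v; as (L_v f)(u) is f(u) if v is the source of u and 0
   otherwise, (E(T) f)(u) = p_{source u} f(u). *)
Definition EG (T : B) : B := diag (vcoef_bounded T).

Lemma vcoef_L w v : vcoef (L w) v = (w == vtx v)%:R.
Proof.
rewrite /vcoef L_xi /concat; case: eqP => [wv|nwv] /=; last first.
  by case: eqVneq nwv => [->|].
have wE : concat w (vtx v) = Some w.
  rewrite /concat wv eqxx; apply/insub_fsgd.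
  by rewrite cats0 /source /edges; case: (val w).
by move: wE; rewrite /concat wv eqxx => -> /=; rewrite eq_sym.
Qed.

Lemma vcoef_Lstar w v : vcoef (Lstar w) v = (w == vtx v)%:R.
Proof.
rewrite /vcoef Lstar_xi; case wE : (ldiv w (vtx v)) => [h|] /=.
  have /ldivP := wE; rewrite /concat; case: eqP => // wh /insub_fsgd /= [vE].
  case wn : (edges w) => [|//]; case hn : (edges h) => [|//] _.
  have hv : h = vtx v.
    apply/val_inj; rewrite /= vE.
    have -> : source w = source h by rewrite -wh /target wn.
    by rewrite -hn; exact: surjective_pairing.
  have -> : w = vtx v.
    by apply/val_inj; rewrite /= vE -wn; exact: surjective_pairing.
  by rewrite hv !eqxx.
case: eqVneq wE => [->|//].
have -> // : ldiv (vtx v) (vtx v) = Some (vtx v).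
by apply/ldivP; rewrite /concat eqxx; apply/insub_fsgd.
Qed.

Lemma Lstar_L w : Lstar w * L w = L (vtx (target w)).
Proof.
apply: bopP => f h; rewrite [LHS]/=.
case wh : (concat w h) => [u|] /=.
  rewrite (proj2 (ldivP _ _ _) wh) /=.
  suff -> : ldiv (vtx (target w)) h = Some h by [].
  move: wh; rewrite /concat; case: eqP => // wh _.
  apply/ldivP; rewrite /concat {1}/target /= {1}/source /= wh eqxx.
  by apply/insub_fsgd; rewrite /source /edges; case: (val h).
case hE : (ldiv _ h) => [h'|] //=.
move: hE wh; rewrite /ldiv /concat {1}/source /=; case: eqP => //= wh _.
rewrite insubT //= admissible_cat (valP w : admissible (source w) _).
by rewrite -/(target w) wh (valP h : admissible (source h) _).
Qed.

(* E extends E(sum_w p_w L_w^{u_w}) = sum_v p_v L_v to a D_G-valued conditional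
   expectation on W*(G). *)
Definition graph_expectation (E : B -> B) : Prop :=
  conditional_expectation Wstar DG E /\
  forall w : fsgd G, is_path w -> E (L w) = 0 /\ E (Lstar w) = 0.

(* E evaluates products of L_w, L_w^* and elements of D_G by the rule
   L_w L_w^* = L_x, where x is the source of w.  This is not an identity between
   operators on H_G (L_w L_w^* xi_x = 0, so that EG maps L_w L_w^* to 0), and hence
   is a condition on E; on the other hand L_w^* L_w = L_y holds, by [Lstar_L]. *)
Definition range_rule (w : fsgd G) (E : B -> B) : Prop :=
  let P := generated_algebra [set T | [\/ DG T, T = L w | T = Lstar w]] in
  forall S T, P S -> P T ->
    E (S * (L w * Lstar w) * T) = E (S * L (vtx (source w)) * T).

End GraphAlgebra.

(* Main.v *)
Require Import Defs.
From mathcomp Require Import all_boot all_order all_algebra.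
From mathcomp Require Import complex reals.
From mathcomp Require Import zify.

Set Implicit Arguments.
Unset Strict Implicit.
Unset Printing Implicit Defensive.

Import Order.TTheory GRing.Theory Num.Theory.

Local Open Scope ring_scope.

(** An element of D_G acts on L_w and on L_w^* by a scalar, so the cumulants to
be computed are scalar multiples of cumulants of words in the two letters
L_w and L_w^*; these are coded by booleans, [true] for L_w.

Both expectations have a notion of good word. For the expectation read off from
Fourier coefficients, where L_w^* annihilates the vertices and L_w creates paths,
the good words are the Dyck words with L_w^* as opening bracket. For an
expectation with the range rule, under which L_w becomes a partial isometry with
initial and final projections in D_G, they are the words with as many L_w as
L_w^*. In both cases a nonempty good factor of a word can be collapsed, under the
expectation, to 0 or to some L_v, and words that are not good have expectation 0
([E_letters]). The nested moment of a word along a noncrossing partition is then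
the plain moment of the word if every block reads a good word, and 0 otherwise
([hatE_good]). Hence a cumulant is a moment times
    sum of mu(P, 1_n) over the noncrossing P all of whose blocks are good
([cumulant_good], [cumulant_scaled]), and what remains is to see that this sum
vanishes for a good word that is not alternating.

Let J be a proper interval of letters, and let [cut_blocks J P] be obtained from P
by cutting each block into its parts inside and outside J; it is the meet of P with
the two-block partition of J and its complement. By Weisner's theorem
([weisner], [sum_mobius_cut]) the sum of mu(P, 1_n) over a fibre of [cut_blocks J]
is 0, so it suffices to partition the set of good P into such fibres, where J may
vary with the fibre ([sum_mobius_fibres]).

For Dyck words, J consists of an adjacent pair of an opening and a closing
bracket: these two letters lie in the same block of every good P, and removing
them does not affect goodness ([sum_mobius_dyck]). Such a J is proper unless the
word has length 2, in which case it is alternating.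

For balanced words no single J works. A word that is not alternating has two equal
adjacent letters; fix the height (number of L_w minus number of L_w^* ) that the
word has reached between them. The intervals J that start and end at this height
and meet each block of P in a balanced set depend only on the fibre of P under any
one of them ([level_pairs_cut]), and there is always one, found by a first-return
argument in a block of one of the two equal letters ([level_pairs_neq0]). *)

(** * Moebius inversion and Weisner's theorem *)

Section MobiusInversion.
Variables (T : finType) (le : rel T).
Hypothesis le_tr : forall y x z, le x y -> le y z -> le x z.
Hypothesis le_anti : forall x y, le x y -> le y x -> x = y.
Hypothesis le_field : forall x y, le x y -> le x x /\ le y y.

Let itv x y := [set z | le x z && le z y].

Lemma card_itv_lt x y z : le x z -> le z y -> z != y ->
  (0 < #|itv x z| < #|itv x y|)%N.
Proof.
move=> xz zy nzy; have [_ zz] := le_field xz; have [_ yy] := le_field zy.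
apply/andP; split; first by apply/card_gt0P; exists z; rewrite inE xz zz.
apply: proper_card; apply/properP; split.
  by apply/subsetP => t; rewrite !inE => /andP[-> tz]; exact: le_tr tz zy.
exists y; rewrite !inE ?(le_tr xz zy) //=.
by apply: contra nzy => /(le_anti zy) ->.
Qed.

(** The recursion on (x, y) only calls (x, z) with [itv x z] strictly smaller, so
fuel beyond the size of [itv x y] is irrelevant. *)
Lemma mobius_rec_fuel k k' x y :
  (maxn 1 #|itv x y| <= k)%N -> (maxn 1 #|itv x y| <= k')%N ->
  mobius_rec le k x y = mobius_rec le k' x y.
Proof.
elim: k k' y => [|k IHk] [|k'] y; rewrite !geq_max // => /andP[_ hk] /andP[_ hk'] /=.
case: eqP => // _; case: ifP => // xy; congr (- _).
apply: eq_bigr => z /and3P[xz zy nzy].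
have /andP[z0 zlt] := card_itv_lt xz zy nzy.
have zk : (#|itv x z| <= k)%N by rewrite -ltnS (leq_trans zlt).
have zk' : (#|itv x z| <= k')%N by rewrite -ltnS (leq_trans zlt).
by apply: IHk; rewrite geq_max ?zk ?zk' (leq_trans z0).
Qed.

Lemma mobiusE x y : mobius le x y =
  if x == y then 1
  else if le x y then - \sum_(z | [&& le x z, le z y & z != y]) mobius le x z
  else 0.
Proof.
have T0 : (0 < #|T|)%N by apply/card_gt0P; exists x.
rewrite [LHS](_ : _ = mobius_rec le #|T|.-1.+1 x y); last by rewrite prednK.
rewrite /=; case: eqP => // _; case: ifP => // xy; congr (- _).
apply: eq_bigr => z /and3P[xz zy nzy].
have /andP[z0 zlt] := card_itv_lt xz zy nzy.
have lk : (#|itv x z| <= #|T|.-1)%N.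
  by rewrite -ltnS prednK // (leq_trans zlt) // max_card.
apply: mobius_rec_fuel; rewrite geq_max ?lk ?(leq_trans z0 lk) //.
by rewrite T0 max_card.
Qed.

(* [le] need not be reflexive everywhere: nc_le fails to be so at sets of sets that
   are not noncrossing partitions. *)
Let leq1 x y := (x == y) || le x y.

Lemma mobius_out x y : ~~ leq1 x y -> mobius le x y = 0.
Proof. by rewrite mobiusE negb_or => /andP[/negbTE -> /negbTE ->]. Qed.

Lemma mobius_sumr x y : \sum_(z | leq1 z y) mobius le x z = (x == y)%:R.
Proof.
have [<-|nxy] := eqVneq x y.
  rewrite (bigD1 x) /leq1 ?eqxx //= mobiusE eqxx big1 ?addr0 // => z.
  case/andP=> /orP[/eqP->|zx nzx]; first by rewrite eqxx.
  apply: mobius_out; rewrite negb_or eq_sym nzx /=.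
  by apply: contra nzx => xz; rewrite (le_anti zx xz).
have [xy|nle] := boolP (le x y); last first.
  rewrite big1 // => z zy; apply: mobius_out; apply: contra nle.
  case/orP=> [/eqP xz|xz].
    by case/orP: zy => [/eqP zy|]; [rewrite xz zy eqxx in nxy | rewrite xz].
  by case/orP: zy => [/eqP <-|/(le_tr xz)].
have [xx yy] := le_field xy.
rewrite (bigD1 y) /leq1 ?eqxx //= mobiusE (negbTE nxy) xy.
apply/eqP; rewrite addrC subr_eq0; apply/eqP.
rewrite [LHS](bigID (fun z => le x z)) /= [X in _ + X]big1 ?addr0.
  apply: eq_bigl => z; case: eqVneq => [->|nzy]; first by rewrite !andbF.
  by rewrite /= !andbT andbC.
move=> z /andP[_ nxz]; apply: mobius_out; rewrite negb_or nxz andbT.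
by apply: contra nxz => /eqP <-.
Qed.

(** The recursion makes the Moebius function inverse to the zeta function on one
side only, which is [mobius_sumr]; being square matrices, they are inverse on the
other side too. *)
Lemma mobius_suml x y : \sum_(z | leq1 x z) mobius le z y = (x == y)%:R.
Proof.
pose e := @enum_val T predT.
pose M := \matrix_(i < #|T|, j < #|T|) mobius le (e i) (e j).
pose Z := \matrix_(i < #|T|, j < #|T|) ((leq1 (e i) (e j))%:R : int).
have MZ : M *m Z = 1%:M.
  apply/matrixP => i j; rewrite !mxE -(inj_eq enum_val_inj) -mobius_sumr.
  rewrite [RHS]big_mkcond (reindex_onto e enum_rank) /=; last first.
    by move=> z _; exact: enum_rankK.
  apply: eq_big => [k|k _]; first by rewrite /e enum_valK eqxx.
  by rewrite !mxE; case: ifP => _; rewrite ?mulr1 ?mulr0.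
have /matrixP/(_ (enum_rank x) (enum_rank y)) := mulmx1C MZ.
rewrite !mxE (inj_eq enum_rank_inj) => <-.
rewrite big_mkcond (reindex_onto e enum_rank) /=; last first.
  by move=> z _; exact: enum_rankK.
apply: eq_big => [k|k _]; first by rewrite /e enum_valK eqxx.
by rewrite !mxE /e !enum_rankK; case: ifP => _; rewrite ?mul1r ?mul0r.
Qed.

(** Weisner's theorem, with the meet with a fixed element below [top] abstracted
to an interior operator [m] into a set U that misses [top]. Summing the claim over
all c above a given b in U gives the sum of mu(x, top) over all x above b, which is 0
because b is not [top]; the single terms follow by downward induction. *)
Lemma weisner (top : T) (U : pred T) (m : T -> T) :
  (forall x, le x x -> [/\ U (m x), le (m x) x &
     forall b, U b -> le b x -> le b (m x)]) ->
  ~~ U top ->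
  forall c, \sum_(x | le x x && (m x == c)) mobius le x top = 0.
Proof.
move=> mP nUtop c; have [k] := ubnP #|[set z | le c z]|.
elim: k c => // k IHk c; rewrite ltnS => ck.
have [/andP[cc Uc]|nc] := boolP (le c c && U c); last first.
  rewrite big1 // => x /andP[xx /eqP mx]; have [Um mle _] := mP _ xx.
  by case/negP: nc; rewrite -mx Um andbT; case: (le_field mle).
have tot : \sum_(x | le x x && le c (m x)) mobius le x top = 0.
  rewrite [RHS](_ : 0 = (c == top)%:R); last first.
    by case: eqP => // ct; rewrite -ct Uc in nUtop.
  rewrite -mobius_suml; apply: eq_bigl => x; apply/andP/idP => [[xx cm]|].
    by have [_ mle _] := mP _ xx; rewrite /leq1 (le_tr cm mle) orbT.
  case/orP=> [/eqP <-|cx]; first by have [_ _ h] := mP _ cc; split; last exact: h.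
  by have [_ xx] := le_field cx; have [_ _ h] := mP _ xx; split; last exact: h.
rewrite -[RHS]tot [RHS](bigID (fun x => m x == c)) /= [X in _ + X](_ : _ = 0).
  rewrite addr0; apply: eq_bigl => x; rewrite -andbA; congr (_ && _).
  by case: eqP => [->|]; rewrite ?cc ?andbF.
rewrite (partition_big m (fun d => le c d && (d != c))) /=; last first.
  by move=> x /andP[/andP[_ ->]].
apply: big1 => d /andP[cd ndc].
rewrite -[RHS](IHk d).
  apply: eq_bigl => x; case: (eqVneq (m x) d) => [->|]; last by rewrite !andbF.
  by rewrite cd ndc !andbT.
apply: leq_trans ck; apply: proper_card; apply/properP; split.
  by apply/subsetP => z; rewrite !inE; exact: le_tr.
exists c; rewrite !inE //; apply: contra ndc => dc.
by rewrite (le_anti dc cd).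
Qed.
End MobiusInversion.

(** * Cutting noncrossing partitions along an interval *)

(* [lia] after discarding the set-theoretic hypotheses, which slow it down. *)
Ltac slia :=
  repeat match goal with
  | H : is_true (in_mem _ _) |- _ => clear H
  | H : is_true (~~ in_mem _ _) |- _ => clear H
  | H : is_true (noncrossing _) |- _ => clear H
  | H : is_true (partition _ _) |- _ => clear H
  | H : is_true (@eq_op (Finite.sort _) _ _) |- _ => clear H
  | H : is_true (~~ (@eq_op (Finite.sort _) _ _)) |- _ => clear H
  | H : forall _, _ |- _ => clear H
  end; lia.

Section NoncrossingLattice.
Variable n : nat.
Implicit Types (P Q : {set {set 'I_n}}) (B C J : {set 'I_n}).

Lemma partition_setTP P :
  reflect [/\ set0 \notin P, forall i, exists2 B, B \in P & i \in B &
             forall B C i, B \in P -> C \in P -> i \in B -> i \in C -> B = C]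
          (partition P [set: 'I_n]).
Proof.
apply: (iffP and3P) => [[/eqP cP tP P0]|[P0 cP tP]]; split=> //.
- move=> i; exists (pblock P i); first by rewrite pblock_mem // cP.
  by rewrite mem_pblock cP.
- by move=> B C i BP CP iB iC; rewrite -(def_pblock tP BP iB) (def_pblock tP CP iC).
- apply/eqP/setP => i; rewrite inE; apply/bigcupP.
  by have [B BP iB] := cP i; exists B.
- apply/trivIsetP => B C BP CP; apply: contraR => /pred0Pn[i /andP[iB iC]].
  by rewrite (tP B C i).
Qed.

Lemma noncrossingP P :
  reflect (partition P [set: 'I_n] /\
           forall B C i j k l, B \in P -> C \in P ->
             i \in B -> j \in C -> k \in B -> l \in C ->
             (i < j)%N -> (j < k)%N -> (k < l)%N -> B = C)
          (noncrossing P).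
Proof.
apply: (iffP andP) => -[pP cP]; split=> //.
  move=> B C i j k l BP CP iB jC kB lC ij jk kl; apply/eqP.
  move/forall_inP/(_ B BP)/forall_inP/(_ C CP): cP => cP.
  apply: contraTT cP => BC; rewrite BC /=.
  apply/forall_inPn; exists i => //; apply/forall_inPn; exists j => //.
  apply/forall_inPn; exists k => //; apply/forall_inPn; exists l => //.
  by rewrite ij jk kl.
apply/forall_inP => B BP; apply/forall_inP => C CP; apply/implyP => BC.
apply/forall_inP => i iB; apply/forall_inP => j jC.
apply/forall_inP => k kB; apply/forall_inP => l lC.
by apply: contra BC => /and3P[ij jk kl]; apply/eqP; apply: (cP B C i j k l).
Qed.

Lemma nc_leP P Q :
  reflect [/\ noncrossing P, noncrossing Q &
             forall B, B \in P -> exists2 C, C \in Q & B \subset C]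
          (nc_le P Q).
Proof.
apply: (iffP and3P) => -[ncP ncQ le]; split=> //.
  by move=> B BP; apply/exists_inP; move/forall_inP: le; apply.
by apply/forall_inP => B BP; apply/exists_inP; exact: le.
Qed.

Lemma nc_le_trans Q P T : nc_le P Q -> nc_le Q T -> nc_le P T.
Proof.
move=> /nc_leP[ncP _ PQ] /nc_leP[_ ncT QT]; apply/nc_leP; split=> // B BP.
have [C CQ BC] := PQ B BP; have [D DT CD] := QT C CQ.
by exists D => //; exact: subset_trans CD.
Qed.

Lemma nc_le_anti P Q : nc_le P Q -> nc_le Q P -> P = Q.
Proof.
suff sub P' Q' : nc_le P' Q' -> nc_le Q' P' -> P' \subset Q'.
  by move=> PQ QP; apply/eqP; rewrite eqEsubset !sub.
move=> /nc_leP[/noncrossingP[/partition_setTP[P0 _ tP] _] _ PQ] /nc_leP[_ _ QP].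
apply/subsetP => B BP; have [C CQ BC] := PQ B BP; have [D DP CD] := QP C CQ.
have [i iB] : exists i, i \in B.
  by apply/set0Pn; apply: contraNneq P0 => <-.
suff BD : B = D by rewrite (_ : B = C) //; apply/eqP; rewrite eqEsubset BC BD.
by apply: (tP B D i) => //; apply: (subsetP CD); apply: (subsetP BC).
Qed.

Lemma nc_le_refl P : nc_le P P = noncrossing P.
Proof. by apply/nc_leP/idP => [[]|ncP] //; split=> // B BP; exists B. Qed.

(** The meet of P with the two-block partition of J and its complement. *)
Definition cut_blocks J P : {set {set 'I_n}} :=
  ([set B :&: J | B in P] :|: [set B :\: J | B in P]) :\ set0.

Lemma cut_blocksP J P C :
  reflect (C != set0 /\ exists2 B, B \in P & C = B :&: J \/ C = B :\: J)
          (C \in cut_blocks J P).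
Proof.
rewrite /cut_blocks !inE; apply: (iffP andP) => -[C0].
  by case/orP=> /imsetP[B BP CB]; split=> //; exists B => //; [left | right].
by case=> B BP BE; split=> //; apply/orP; case: BE => ->; [left|right]; exact: imset_f.
Qed.

Definition convex J : Prop :=
  forall i j k : 'I_n, i \in J -> k \in J -> (i < j)%N -> (j < k)%N -> j \in J.

Lemma cut_blocks_noncrossing J P : convex J -> noncrossing P -> noncrossing (cut_blocks J P).
Proof.
move=> cJ /noncrossingP[/partition_setTP[P0 cP tP] ncP].
have inB B C i : C = B :&: J \/ C = B :\: J -> i \in C -> i \in B.
  by case=> ->; rewrite inE => /andP[].
apply/noncrossingP; split; first apply/partition_setTP; first split.
- by rewrite /cut_blocks !inE eqxx.
- move=> i; have [B BP iB] := cP i; have [iJ|niJ] := boolP (i \in J).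
    have iC : i \in B :&: J by rewrite inE iB.
    exists (B :&: J) => //; apply/cut_blocksP; split; last by exists B => //; left.
    by apply/set0Pn; exists i.
  have iC : i \in B :\: J by rewrite inE iB niJ.
  exists (B :\: J) => //; apply/cut_blocksP; split; last by exists B => //; right.
  by apply/set0Pn; exists i.
- move=> C1 C2 i /cut_blocksP[_ [B1 B1P C1E]] /cut_blocksP[_ [B2 B2P C2E]] iC1 iC2.
  have eB : B1 = B2.
    by apply: (tP B1 B2 i) => //; [exact: inB C1E iC1|exact: inB C2E iC2].
  case: C1E C2E iC1 iC2 => -> [] ->; rewrite eB // !inE.
    by case/andP=> _ -> /andP[].
  by case/andP=> /negbTE -> _ /andP[].
move=> C1 C2 i j k l /cut_blocksP[_ [B1 B1P C1E]] /cut_blocksP[_ [B2 B2P C2E]].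
move=> iC jC kC lC ij jk kl.
have eB : B1 = B2.
  apply: (ncP B1 B2 i j k l) => //.
  - exact: inB C1E iC.
  - exact: inB C2E jC.
  - exact: inB C1E kC.
  - exact: inB C2E lC.
case: C1E C2E iC jC kC lC => -> [] ->; rewrite eB // !inE.
  move=> /andP[_ iJ] /andP[njJ _] /andP[_ kJ] _.
  by rewrite (cJ i j k) in njJ.
move=> _ /andP[_ jJ] /andP[nkJ _] /andP[_ lJ].
by rewrite (cJ j k l) in nkJ.
Qed.

(** Lying below the two-block partition of J and its complement. *)
Definition refines J Q := [forall B in Q, (B \subset J) || (B \subset ~: J)].

Lemma cut_blocks_meet J P : convex J -> noncrossing P ->
  [/\ refines J (cut_blocks J P), nc_le (cut_blocks J P) P &
     forall Q, refines J Q -> nc_le Q P -> nc_le Q (cut_blocks J P)].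
Proof.
move=> cJ ncP; have ncS := cut_blocks_noncrossing cJ ncP; split.
- apply/forall_inP => C /cut_blocksP[_ [B _ [] ->]]; first by rewrite subsetIr.
  by rewrite setDE subsetIr orbT.
- apply/nc_leP; split=> // C /cut_blocksP[_ [B BP [] ->]]; exists B => //.
    exact: subsetIl.
  exact: subsetDl.
move=> Q /forall_inP QJ /nc_leP[ncQ _ QP]; apply/nc_leP; split=> // C CQ.
have [B BP CB] := QP C CQ.
have C0 : C != set0.
  have /noncrossingP[/partition_setTP[Q0 _ _] _] := ncQ.
  by apply: contraNneq Q0 => <-.
case/orP: (QJ C CQ) => CJ.
  have CBJ : C \subset B :&: J by rewrite subsetI CB.
  exists (B :&: J) => //; apply/cut_blocksP; split; last by exists B => //; left.
  by apply: contraNneq C0 => B0; rewrite -subset0 -B0.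
have CBJ : C \subset B :\: J by rewrite setDE subsetI CB.
exists (B :\: J) => //; apply/cut_blocksP; split; last by exists B => //; right.
by apply: contraNneq C0 => B0; rewrite -subset0 -B0.
Qed.

Lemma sum_mobius_cut J Q : convex J -> J != set0 -> J != setT ->
  \sum_(P | noncrossing P && (cut_blocks J P == Q))
     mobius (@nc_le n) P [set [set: 'I_n]] = 0.
Proof.
move=> cJ J0 JT; rewrite -[RHS](@weisner _ (@nc_le n) _ _ _
  [set [set: 'I_n]] (refines J) (cut_blocks J) _ _ Q).
- by apply: eq_bigl => P; rewrite nc_le_refl.
- by move=> P T S; exact: nc_le_trans.
- exact: nc_le_anti.
- by move=> P T /nc_leP[ncP ncT _]; rewrite !nc_le_refl.
- by move=> P; rewrite nc_le_refl => ncP; exact: cut_blocks_meet.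
apply/forall_inPn; exists setT; rewrite ?inE // negb_or.
apply/andP; split; first by rewrite subTset.
by rewrite subTset -setC0 (inj_eq (@setC_inj _)).
Qed.

(** The good partitions are a disjoint union of fibres of maps [cut_blocks (J k)]:
the third hypothesis says that the set JJ P, hence the k picked from it, and
goodness are constant on the fibre of P. Each fibre contributes 0. *)
Lemma sum_mobius_fibres (K : finType) (J : K -> {set 'I_n})
    (good : pred {set {set 'I_n}}) (JJ : {set {set 'I_n}} -> {set K}) :
  (forall P, noncrossing P -> good P -> JJ P != set0) ->
  (forall P k, noncrossing P -> good P -> k \in JJ P ->
     [/\ convex (J k), J k != set0 & J k != setT]) ->
  (forall P Q k, noncrossing P -> noncrossing Q -> good P -> k \in JJ P ->
     cut_blocks (J k) Q = cut_blocks (J k) P -> good Q /\ JJ Q = JJ P) ->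
  \sum_(P | noncrossing P && good P) mobius (@nc_le n) P [set [set: 'I_n]] = 0.
Proof.
move=> JJ0 JJp JJc; pose key P := [pick k in JJ P].
pose F P := (key P, oapp (fun k => cut_blocks (J k) P) set0 (key P)).
rewrite (partition_big F predT) //=; apply: big1 => -[k0 Q] _.
pose S := [pred P | noncrossing P && good P && (F P == (k0, Q))].
have [P0 SP0|S0] := pickP S; last by rewrite (eq_bigl pred0) ?big_pred0.
have /andP[/andP[nc0 g0] /eqP[kE QE]] := SP0.
have [k keyk kJ] : exists2 k, key P0 = Some k & k \in JJ P0.
  rewrite /key; case: pickP => [k kJ|J0]; first by exists k.
  by case/set0Pn: (JJ0 _ nc0 g0) => k; rewrite J0.
rewrite keyk /= in kE QE; have [cJ Jn0 JnT] := JJp _ _ nc0 g0 kJ.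
rewrite -[RHS](sum_mobius_cut Q cJ Jn0 JnT); apply: eq_bigl => P.
apply/idP/idP => [/andP[/andP[ncP gP] /eqP[kP]]|/andP[ncP /eqP sP]].
  by rewrite /F kP -kE ncP /= => ->.
have [gP JP] := JJc _ _ _ nc0 ncP g0 kJ (etrans sP (esym QE)).
by rewrite ncP gP /F /key JP -/(key P0) keyk /= sP kE.
Qed.

End NoncrossingLattice.

(** * Partitions whose blocks read good words *)

Section GoodWords.

(** Good words can be erased wherever they occur as factors; this is what allows
the blocks of a noncrossing partition to be removed from the inside out. *)
Definition insertion_invariant (T : Type) (good : pred (seq T)) : Prop :=
  good [::] /\ forall u v t, good v -> good (u ++ v ++ t) = good (u ++ t).

Variables (n : nat) (T : Type) (eps : 'I_n -> T).
Implicit Types (P Q : {set {set 'I_n}}) (B C : {set 'I_n}).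

Definition segment a b : {set 'I_n} := [set i : 'I_n | (a <= i < b)%N].

Lemma convex_segment a b : convex (segment a b).
Proof. by move=> i j k; rewrite !inE => /andP[? ?] /andP[? ?] ? ?; slia. Qed.

Definition block_word B : seq T := [seq eps i | i <- enum B].

Lemma block_word1 i : block_word [set i] = [:: eps i].
Proof. by rewrite /block_word enum_set1. Qed.

Lemma enum_cut B c :
  enum B = enum (B :&: segment 0 c) ++ enum (B :&: segment c n).
Proof.
have -> : enum (B :&: segment 0 c) = [seq i : 'I_n <- enum B | (i < c)%N].
  rewrite /enum_mem -filter_predI; apply: eq_filter => i /=.
  by rewrite !inE andbC.
have -> : enum (B :&: segment c n) = [seq i : 'I_n <- enum B | (c <= i)%N].
  rewrite /enum_mem -filter_predI; apply: eq_filter => i /=.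
  by rewrite !inE ltn_ord andbT andbC.
have : sorted (fun i j : 'I_n => (i < j)%N) (enum B).
  rewrite {1}/enum_mem -enumT; apply: sorted_filter => [i j k|]; first exact: ltn_trans.
  by have := iota_ltn_sorted 0 n; rewrite -val_enum_ord sorted_map.
elim: (enum B) => //= i s IHs ps; have [ic|ci] := ltnP i c.
  by rewrite /= -IHs // (path_sorted ps).
have /allP sl : all (fun j : 'I_n => (i < j)%N) s.
  by apply: order_path_min ps => j k l; exact: ltn_trans.
rewrite (eq_in_filter (a2 := pred0)) ?filter_pred0 //=; last first.
  by move=> j /sl ij; apply/negbTE; rewrite -leqNgt (leq_trans ci) // ltnW.
congr cons; rewrite (eq_in_filter (a2 := predT)) ?filter_predT //.
by move=> j /sl ij; rewrite (leq_trans ci) // ltnW.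
Qed.

Lemma block_word_segment B a b : (a <= b)%N ->
  block_word B = block_word (B :&: segment 0 a) ++
                 block_word (B :&: segment a b) ++ block_word (B :&: segment b n)
  /\ block_word (B :\: segment a b) =
     block_word (B :&: segment 0 a) ++ block_word (B :&: segment b n).
Proof.
move=> ab; rewrite /block_word -!map_cat; split; congr map.
  rewrite (enum_cut B a); congr cat; rewrite (enum_cut _ b); congr (_ ++ _).
    by apply: eq_enum => i; rewrite !inE; case: (i \in B) => //=; have := ltn_ord i; slia.
  by apply: eq_enum => i; rewrite !inE; case: (i \in B) => //=; have := ltn_ord i; slia.
rewrite (enum_cut _ a); congr (_ ++ _).
  by apply: eq_enum => i; rewrite !inE; case: (i \in B) => //=; have := ltn_ord i; slia.
by apply: eq_enum => i; rewrite !inE; case: (i \in B) => //=; have := ltn_ord i; slia.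
Qed.

Variable good : pred (seq T).
Hypothesis good_ins : insertion_invariant good.

Definition good_part P := [forall B in P, good (block_word B)].

Lemma cut_good_cap J P : good_part (cut_blocks J P) ->
  forall B, B \in P -> good (block_word (B :&: J)).
Proof.
move=> /forall_inP gS B BP; have [->|BJ] := eqVneq (B :&: J) set0.
  by rewrite /block_word enum_set0; case: good_ins.
by apply: gS; apply/cut_blocksP; split=> //; exists B => //; left.
Qed.

(** The part of a block outside a segment is the block with a factor erased. *)
Lemma good_cut a b P : (a <= b)%N -> set0 \notin P ->
  (forall B, B \in P -> good (block_word (B :&: segment a b))) ->
  good_part (cut_blocks (segment a b) P) = good_part P.
Proof.
move=> ab P0 gB; have [g0 gi] := good_ins.
have gD B : B \in P -> good (block_word (B :\: segment a b)) = good (block_word B).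
  move=> BP; have [-> ->] := block_word_segment B ab; rewrite gi //; exact: gB.
apply/forall_inP/forall_inP => [gS B BP|gP C /cut_blocksP[_ [B BP [] ->]]].
- rewrite -gD //; have [->|BJ] := eqVneq (B :\: segment a b) set0.
    by rewrite /block_word enum_set0.
  by apply: gS; apply/cut_blocksP; split=> //; exists B => //; right.
- exact: gB.
- by rewrite gD //; exact: gP.
Qed.

End GoodWords.

(** * The Moebius sum for Dyck words *)

Section Dyck.

(** [false] is an opening bracket, [true] a closing one, and h the number of brackets
open at the start. *)
Fixpoint dyck (h : nat) (u : seq bool) : bool :=
  match u with
  | [::] => h == 0%N
  | false :: u' => dyck h.+1 u'
  | true :: u' => if h is h'.+1 then dyck h' u' else false
  end.

Lemma dyck_cat h k v t : dyck k v -> dyck (k + h)%N (v ++ t) = dyck h t.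
Proof.
elim: v k => [|[] v IHv] k /=; first by move/eqP->.
  by case: k => // k; exact: IHv.
by rewrite -addSn; exact: IHv.
Qed.

Lemma dyck_insertion : insertion_invariant (dyck 0).
Proof.
split=> // u v t gv; elim: u 0%N => [|e u IHu] h; first exact: (@dyck_cat h 0 v t).
by case: e => /=; [case: h | ].
Qed.

Lemma dyck_rcons_false h u : dyck h (rcons u false) = false.
Proof. by elim: u h => [|[] u IHu] [|h] //=. Qed.

Lemma dyck_last h u : u != [::] -> dyck h u -> last false u.
Proof.
by case/lastP: u => // u [] _; rewrite last_rcons // dyck_rcons_false.
Qed.

Lemma peak u : last false (false :: u) ->
  exists u1 u2, false :: u = u1 ++ [:: false; true] ++ u2.
Proof.
elim: u => //= -[] u IHu lu; first by exists [::], u.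
by have [u1 [u2 uE]] := IHu lu; exists (false :: u1), u2; rewrite uE.
Qed.

Variables (n : nat) (eps : 'I_n -> bool).

(** If P is good, then i, being an opening bracket, is followed by a letter of its
block, and j = i + 1, being a closing one, is preceded by a letter of its own block.
These two letters would make the blocks cross if they were different. *)
Lemma sum_mobius_dyck (i j : 'I_n) : (2 < n)%N -> j = i.+1 :> nat ->
  eps i = false -> eps j = true ->
  \sum_(P | noncrossing P && good_part eps (dyck 0) P)
     mobius (@nc_le n) P [set [set: 'I_n]] = 0.
Proof.
move=> n3 ji ei ej; pose J := segment n i i.+2.
have iJ : i \in J by rewrite !inE; slia.
have jJ : j \in J by rewrite !inE; slia.
have JE : J = [set i; j].
  apply/setP => k; rewrite !inE -!val_eqE /= ji; slia.
have wordJ : block_word eps J = [:: false; true].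
  rewrite /block_word (enum_cut J j).
  have -> : J :&: segment n 0 j = [set i].
    by apply/setP => k; rewrite !inE -!val_eqE /=; slia.
  have -> : J :&: segment n j n = [set j].
    by apply/setP => k; rewrite !inE -!val_eqE /=; have := ltn_ord k; slia.
  by rewrite !enum_set1 /= ei ej.
have cap P : noncrossing P -> good_part eps (dyck 0) P -> forall B, B \in P ->
    dyck 0 (block_word eps (B :&: J)).
  move=> /noncrossingP[/partition_setTP[_ cP tP] ncP] /forall_inP gP B BP.
  suff ijB : (i \in B) = (j \in B).
    have [iB|niB] := boolP (i \in B).
      rewrite (_ : B :&: J = J) ?wordJ //; apply/setIidPr; rewrite JE.
      by apply/subsetP => k; rewrite !inE => /orP[]/eqP->; rewrite -?ijB.
    rewrite (_ : B :&: J = set0) /block_word ?enum_set0 //.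
    apply/setP => k; rewrite JE !inE; apply/negbTE; apply: contra niB.
    by case/andP=> kB /orP[]/eqP ki; [rewrite -ki|rewrite ijB -ki].
  have [Bi BiP iBi] := cP i; have [Bj BjP jBj] := cP j.
  suff BE : Bi = Bj.
    apply/idP/idP => h; first by rewrite (tP B Bi i BP BiP h iBi) BE.
    by rewrite (tP B Bj j BP BjP h jBj) -BE.
  apply/eqP/negPn/negP => nB.
  (* An opening bracket cannot end a Dyck word. *)
  have [l lB il] : exists2 l, l \in Bi & (i < l)%N.
    apply/exists_inP; apply: contraLR (gP Bi BiP) => /exists_inPn nl.
    have [-> _] := block_word_segment eps Bi (leqnSn i).
    rewrite [X in _ ++ _ ++ X](_ : _ = [::]); last first.
      rewrite /block_word (_ : _ :&: _ = set0) ?enum_set0 //.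
      apply/setP => k; rewrite !inE; apply/negbTE; rewrite ltn_ord andbT.
      by apply/negP => /andP[kB /(fun h => negP (nl k kB) h)].
    rewrite (_ : Bi :&: segment n i i.+1 = [set i]).
      by rewrite block_word1 ei cats0 cats1 dyck_rcons_false.
    apply/setP => k; rewrite !inE -val_eqE /=.
    apply/andP/idP => [[_]|/eqP ki]; first slia.
    by rewrite (val_inj ki); split=> //; slia.
  (* A closing bracket cannot begin a Dyck word. *)
  have [k kB kj] : exists2 k, k \in Bj & (k < j)%N.
    apply/exists_inP; apply: contraLR (gP Bj BjP) => /exists_inPn nl.
    have [-> _] := block_word_segment eps Bj (leqnSn j).
    rewrite [X in X ++ _](_ : _ = [::]); last first.
      rewrite /block_word (_ : _ :&: _ = set0) ?enum_set0 //.
      apply/setP => k; rewrite !inE; apply/negbTE.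
      by apply/negP => /andP[kB /(fun h => negP (nl k kB) h)].
    rewrite (_ : Bj :&: segment n j j.+1 = [set j]).
      by rewrite block_word1 ej.
    apply/setP => k; rewrite !inE -val_eqE /=.
    apply/andP/idP => [[_]|/eqP kj]; first slia.
    by rewrite (val_inj kj); split=> //; slia.
  have jl : (j < l)%N.
    rewrite ltn_neqAle ji il andbT -ji; apply: contra nB => /eqP jl.
    by apply/eqP; apply: (tP Bi Bj j) => //; rewrite (val_inj jl).
  have ki : (k < i)%N.
    rewrite ltn_neqAle -ltnS -ji kj andbT; apply: contra nB => /eqP ki.
    by apply/eqP; apply: (tP Bi Bj i) => //; rewrite -(val_inj ki).
  case/negP: nB; rewrite eq_sym; apply/eqP.
  by apply: (ncP Bj Bi k i j l) => //; rewrite ji.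
apply: (@sum_mobius_fibres n unit (fun _ => J) _ (fun _ => setT)).
- by move=> P _ _; apply/set0Pn; exists tt; rewrite inE.
- move=> P [] _ _ _; split; first exact: convex_segment.
    by apply/set0Pn; exists i.
  rewrite JE; apply/eqP => /(congr1 (fun A : {set 'I_n} => #|A|)).
  by rewrite cardsT card_ord cards2; slia.
move=> P Q _ ncP ncQ gP _ sPQ; split=> //.
have set0N R : noncrossing R -> set0 \notin R.
  by move=> /noncrossingP[/partition_setTP[]].
have gS : good_part eps (dyck 0) (cut_blocks J Q).
  rewrite sPQ (good_cut dyck_insertion) ?set0N //; first slia.
  exact: cap.
rewrite -(good_cut dyck_insertion (_ : (i <= i.+2)%N)) ?set0N //; first slia.
exact: (cut_good_cap dyck_insertion).
Qed.

End Dyck.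

(** * The Moebius sum for balanced words *)

Section Balanced.

Definition bracket (e : bool) : int := if e then 1 else -1.

Definition balanced (u : seq bool) : bool := \sum_(e <- u) bracket e == 0.

Lemma balanced_insertion : insertion_invariant balanced.
Proof.
rewrite /balanced; split=> [|u v t /eqP v0]; first by rewrite big_nil.
by rewrite !big_cat /= v0 add0r.
Qed.

Variables (n : nat) (eps : 'I_n -> bool).
Implicit Types (P Q : {set {set 'I_n}}) (B C : {set 'I_n}).

Definition weight B a b : int :=
  \sum_(i in B) if (a <= i < b)%N then bracket (eps i) else 0.

Lemma weight_cat B a b c : (a <= b)%N -> (b <= c)%N ->
  weight B a c = weight B a b + weight B b c.
Proof.
move=> ab bc; rewrite /weight -big_split; apply: eq_bigr => i _ /=.
by do ![case: ifP]; rewrite ?addr0 ?add0r // => *; slia.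
Qed.

Lemma weight_neq0 B a b : weight B a b != 0 -> exists2 i, i \in B & (a <= i < b)%N.
Proof.
move=> B0; apply/exists_inP; apply: contraNT B0 => /exists_inPn nB.
by rewrite /weight big1 // => i iB; rewrite ifN ?nB.
Qed.

Lemma weight_eq0 B a b : (forall i, i \in B -> ~~ (a <= i < b)%N) -> weight B a b = 0.
Proof.
by move=> nB; apply: contraTeq isT => /weight_neq0[i /nB]; case: (_ && _).
Qed.

Lemma weight_step B a : weight B a a.+1 =
  \sum_(i in B | i == a :> nat) bracket (eps i).
Proof.
rewrite /weight -big_mkcondr; apply: eq_bigl => i; congr (_ && _); slia.
Qed.

Lemma weight_step1 B (i : 'I_n) : i \in B -> weight B i i.+1 = bracket (eps i).
Proof.
move=> iB; rewrite weight_step (big_pred1 i) // => j.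
by rewrite /= -val_eqE; case: eqVneq => [/val_inj ->|]; rewrite ?iB ?andbF.
Qed.

Lemma weight_step_bound B a : -1 <= weight B a a.+1 <= 1.
Proof.
have [->|/weight_neq0[i iB ia]] := eqVneq (weight B a a.+1) 0; first by [].
have <- : i = a :> nat by slia.
by rewrite weight_step1 //; case: (eps i).
Qed.

Lemma weight_partition P a b : partition P [set: 'I_n] ->
  weight setT a b = \sum_(B in P) weight B a b.
Proof. exact: set_partition_big. Qed.

Lemma weight_cap B a b a' b' :
  weight (B :&: segment n a b) a' b' = weight B (maxn a a') (minn b b').
Proof.
rewrite /weight -big_mkcondr -[RHS]big_mkcondr; apply: eq_bigl => i.
rewrite !inE; case: (i \in B) => //=; slia.
Qed.

Lemma weight_cut B a b a' b' :
  weight B a' b' =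
  weight (B :&: segment n a b) a' b' + weight (B :\: segment n a b) a' b'.
Proof. by rewrite /weight (big_setID (segment n a b)). Qed.

Lemma weight_segment B a b :
  balanced (block_word eps (B :&: segment n a b)) = (weight B a b == 0).
Proof.
rewrite /balanced big_map big_enum /= /weight -big_mkcondr; congr (_ == _).
by apply: eq_bigl => i; rewrite !inE.
Qed.

Lemma weight_total B : balanced (block_word eps B) = (weight B 0 n == 0).
Proof.
rewrite -weight_segment; congr (balanced (block_word eps _)).
by apply/setP => i; rewrite !inE /= ltn_ord ?andbT.
Qed.

Local Notation bal := (good_part eps balanced).

Lemma balP P : reflect (forall B, B \in P -> weight B 0 n = 0) (bal P).
Proof.
apply: (iffP forall_inP) => h B BP; last by rewrite weight_total h ?eqxx.
by apply/eqP; rewrite -weight_total; exact: h.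
Qed.

(** A block whose part in [a', b) is unbalanced also has letters in [a, a') and in
[b, b'), to restore the balance of its parts in [a, b) and [a', b'). Two blocks
meeting three consecutive intervals cross, so at most one block is unbalanced on
[a', b); but the imbalances on [a', b) add up to 0. *)
Lemma weight_cross P a a' b b' : noncrossing P ->
  (a <= a')%N -> (a' <= b)%N -> (b <= b')%N ->
  (forall B, B \in P -> weight B a b = 0) ->
  (forall B, B \in P -> weight B a' b' = 0) ->
  weight setT a' b = 0 ->
  forall B, B \in P -> weight B a' b = 0.
Proof.
move=> /noncrossingP[pP ncP] aa' a'b bb' hab ha'b' hT B BP.
have /partition_setTP[_ _ tP] := pP.
apply: contra_eq hT => nB; rewrite (weight_partition _ _ pP) (bigD1 B) //=.
rewrite big1 ?addr0 // => C /andP[CP]; apply: contraNeq => nC.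
have pts D : D \in P -> weight D a' b != 0 ->
    [/\ exists2 i, i \in D & (a <= i < a')%N, exists2 i, i \in D & (a' <= i < b)%N
      & exists2 i, i \in D & (b <= i < b')%N].
  move=> DP nD; split; apply: weight_neq0 => //.
    by have := hab D DP; rewrite (weight_cat D aa' a'b) => /eqP; rewrite addr_eq0 => /eqP->; rewrite oppr_eq0.
  by have := ha'b' D DP; rewrite (weight_cat D a'b bb') addrC => /eqP; rewrite addr_eq0 => /eqP->; rewrite oppr_eq0.
have [[i iB hi] [j jB hj] [k kB hk]] := pts B BP nB.
have [[i' iC hi'] [j' jC hj'] [k' kC hk']] := pts C CP nC.
apply/eqP; have [ii'|i'i|/val_inj ii'] := ltngtP i i'.
- by apply/esym/(ncP B C i i' j k') => //; slia.
- by apply: (ncP C B i' i j' k) => //; slia.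
- by apply: (tP C B i) => //; rewrite ii'.
Qed.

Section Adjacent.
Variables g g' : 'I_n.
Hypotheses (gS : g' = g.+1 :> nat) (egg' : eps g = eps g').

(** A pair (a, b) stands for the letters a, ..., b - 1, so that a and b are
positions between letters, 0 and n being the two ends; g' is the position between
the letters g and g'. *)
Definition level_pairs P : {set 'I_n.+1 * 'I_n.+1} :=
  [set k : 'I_n.+1 * 'I_n.+1 | [&& (k.1 < k.2)%N, ~~ ((k.1 == 0 :> nat) && (k.2 == n :> nat)),
    weight setT 0 k.1 == weight setT 0 g', weight setT 0 k.2 == weight setT 0 g' &
    [forall B in P, weight B k.1 k.2 == 0]]].

Lemma level_pairsP P (a b : 'I_n.+1) :
  reflect [/\ (a < b)%N, ~~ ((a == 0 :> nat) && (b == n :> nat)),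
              weight setT 0 a = weight setT 0 g', weight setT 0 b = weight setT 0 g' &
              forall B, B \in P -> weight B a b = 0]
    ((a, b) \in level_pairs P).
Proof.
rewrite inE /=; apply: (iffP and5P) => -[ab n0 /eqP la /eqP lb h]; split=> //.
- by move=> B BP; apply/eqP; move/forall_inP: h; apply.
- by apply/forall_inP => B BP; apply/eqP; exact: h.
Qed.

Lemma weight_level a b : (a <= b)%N ->
  weight setT 0 a = weight setT 0 g' -> weight setT 0 b = weight setT 0 g' ->
  weight setT a b = 0.
Proof.
move=> ab la lb; have := weight_cat setT (leq0n a) ab; rewrite la lb.
by rewrite -[X in X = _]addr0 => /addrI.
Qed.

(** Cutting along one such segment preserves the others, since by [weight_cross]
the intersection of two of them again meets all blocks in balanced sets. *)
Lemma level_pairs_cut P (a b : 'I_n.+1) : noncrossing P ->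
  (a, b) \in level_pairs P ->
  level_pairs (cut_blocks (segment n a b) P) = level_pairs P.
Proof.
move=> ncP /level_pairsP[ab n0 la lb hab]; apply/setP => -[a' b'].
have capP B : B \in P -> (a', b') \in level_pairs P ->
    weight (B :&: segment n a b) a' b' = 0.
  move=> BP /level_pairsP[ab' n0' la' lb' ha'b']; rewrite weight_cap.
  have [aa'|a'a] := leqP a a'; have [bb'|b'b] := leqP b b'.
  - rewrite ?(maxn_idPr aa') ?(minn_idPl bb').
    have [a'b|ba'] := leqP a' b; last by apply: weight_eq0 => i _; slia.
    by apply: (weight_cross ncP aa' a'b bb') => //; exact: weight_level.
  - by rewrite ?(maxn_idPr aa') ?(minn_idPr (ltnW b'b)) ha'b'.
  - by rewrite ?(maxn_idPl (ltnW a'a)) ?(minn_idPl bb') hab.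
  - rewrite ?(maxn_idPl (ltnW a'a)) ?(minn_idPr (ltnW b'b)).
    have [ab''|b'a] := leqP a b'; last by apply: weight_eq0 => i _; slia.
    by apply: (weight_cross ncP (ltnW a'a) ab'' (ltnW b'b)) => //; exact: weight_level.
apply/idP/idP => h; have /level_pairsP[ab' n0' la' lb' hs] := h;
  apply/level_pairsP; split=> //.
  move=> B BP; rewrite (weight_cut B a b).
  have hC C : (C = B :&: segment n a b \/ C = B :\: segment n a b) -> weight C a' b' = 0.
    move=> CE; have [->|C0] := eqVneq C set0; first by rewrite /weight big_set0.
    by apply: hs; apply/cut_blocksP; split=> //; exists B.
  by rewrite !hC ?addr0 //; [right | left].
move=> C /cut_blocksP[_ [B BP [] ->]]; first exact: capP.
by have := weight_cut B a b a' b'; rewrite hs // capP // add0r => <-.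
Qed.

(** A block of a noncrossing partition has all or none of its letters between two
letters of another block. *)
Lemma weight_between P B C (i j : 'I_n) : noncrossing P -> bal P ->
  B \in P -> C \in P -> C != B -> i \in B -> j \in B -> (i <= j)%N ->
  weight C i j.+1 = 0.
Proof.
move=> /noncrossingP[/partition_setTP[_ _ tP] ncP] /balP bP BP CP nCB iB jB ij.
apply/eqP/negPn/negP => nC; have [c cC hc] := weight_neq0 nC.
have nC_B d : d \in C -> d \notin B.
  by move=> dC; apply: contra nCB => dB; apply/eqP; exact: (tP C B d).
have ci : c != i :> nat by apply: contraNneq (nC_B c cC) => /val_inj ->.
have cj : c != j :> nat by apply: contraNneq (nC_B c cC) => /val_inj ->.
case/negP: nC; rewrite -(bP C CP); apply/eqP; rewrite /weight.
apply: eq_bigr => d dC; congr (if _ then _ else _).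
have di : d != i :> nat by apply: contraNneq (nC_B d dC) => /val_inj ->.
have dj : d != j :> nat by apply: contraNneq (nC_B d dC) => /val_inj ->.
have dn := ltn_ord d.
apply/idP/idP => [|_]; first by slia.
have [d_i|i_d|] := ltngtP d i; last by move/eqP; rewrite (negbTE di).
  by case/eqP: nCB; apply: (ncP C B d i c j) => //; slia.
have [//|j_d|] := ltngtP d j; first by slia.
  by case/eqP: nCB; apply/esym/(ncP B C i c j d) => //; slia.
by move/eqP; rewrite (negbTE dj).
Qed.

(** Follow the balance of the block B of g' from g' onwards, and of the block B' of
g from g backwards. A first return to 0 of either one ends a segment as required,
the other blocks being inside or outside by [weight_between]. If neither returns,
their signs exclude B = B', and they produce a letter of B before g and a letter of
B' after g', so that B and B' cross. *)
Lemma level_pairs_neq0 P : noncrossing P -> bal P -> level_pairs P != set0.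
Proof.
move=> ncP bP; have /noncrossingP[pP ncP'] := ncP; have /balP bP' := bP.
have /partition_setTP[_ cP tP] := pP.
have [B BP g'B] := cP g'; have [B' B'P gB'] := cP g.
have gn := ltn_ord g; have g'n := ltn_ord g'.
have level a b : (a <= b)%N -> (forall C, C \in P -> weight C a b = 0) ->
    weight setT 0 b = weight setT 0 a.
  move=> ab hC; rewrite (weight_cat _ (leq0n a) ab).
  by rewrite [X in _ + X](weight_partition _ _ pP) big1 ?addr0.
(* The first return of B ends with a letter j of B, so [weight_between] applies to
   the other blocks. *)
have [/existsP/= ex_q|] := boolP [exists q : 'I_n.+1, (g' < q)%N && (weight B g' q == 0)].
  pose p q := [&& (g' < q)%N, (q <= n)%N & weight B g' q == 0].
  have exp : exists q, p q.
    by case: ex_q => q /andP[gq qB]; exists q; rewrite /p gq qB -ltnS ltn_ord.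
  case: (ex_minnP exp) => -[|q] /and3P[gq qn /eqP qB] qmin; first by [].
  have qn' : (q < n)%N by [].
  pose j := Ordinal qn'.
  have jB : j \in B.
    apply/negPn/negP => njB; have wq : weight B q q.+1 = 0.
      apply: weight_eq0 => i iB; apply: contra njB => hi.
      by rewrite (_ : j = i) //; apply: val_inj => /=; slia.
    have gq' : (g' < q)%N.
      rewrite ltn_neqAle -ltnS gq andbT; apply/eqP => gq'.
      by move: qB; rewrite -gq' weight_step1 //; case: (eps g').
    have := qmin q; rewrite /p gq' (ltnW qn') /= ltnn.
    move: qB; rewrite (@weight_cat B g' q q.+1) //.
    by rewrite wq addr0 => -> /(_ (eqxx _)).
  have hC C : C \in P -> weight C g' q.+1 = 0.
    move=> CP; have [->//|nCB] := eqVneq C B.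
    exact: (@weight_between P B C g' j).
  apply/set0Pn; exists (inord g', inord q.+1); apply/level_pairsP.
  rewrite !inordK ?ltnS //; last exact: ltnW.
  by split=> //; [rewrite gS | rewrite (@level g' q.+1) // ltnW].
rewrite negb_exists => /forallP/= no_q.
have [/existsP/= ex_q|] := boolP [exists q : 'I_n, (q <= g)%N && (weight B' q g' == 0)].
  pose p q := (q <= g)%N && (weight B' q g' == 0).
  have exp : exists q, p q by case: ex_q => q; exists q.
  have pg q : p q -> (q <= g)%N by case/andP.
  case: (ex_maxnP exp pg) => q /andP[qg /eqP qB] qmax.
  have qn' : (q < n)%N by exact: leq_ltn_trans gn.
  pose j := Ordinal qn'.
  have jB : j \in B'.
    apply/negPn/negP => njB; have wq : weight B' q q.+1 = 0.
      apply: weight_eq0 => i iB; apply: contra njB => hi.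
      by rewrite (_ : j = i) //; apply: val_inj => /=; slia.
    have qg' : (q < g)%N.
      rewrite ltn_neqAle qg andbT; apply/eqP => qg'.
      by move: qB; rewrite qg' gS weight_step1 //; case: (eps g).
    have := qmax q.+1; rewrite /p qg' /= ltnn.
    move: qB; rewrite (@weight_cat B' q q.+1 g') //; last by rewrite gS ltnS.
    by rewrite wq add0r => -> /(_ (eqxx _)).
  have hC C : C \in P -> weight C q g' = 0.
    move=> CP; have [->//|nCB] := eqVneq C B'.
    by rewrite gS; exact: (@weight_between P B' C j g).
  apply/set0Pn; exists (inord q, inord g'); apply/level_pairsP.
  rewrite !inordK ?ltnS //; try exact: ltnW.
  split=> //; first by rewrite gS ltnS.
    by rewrite negb_and (ltn_eqF g'n) orbT.
  by rewrite -(@level q g') // gS ltnW.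
rewrite negb_exists => /forallP/= no_q'.
(* Without return, the balance of B after g', and that of B' before g', keep the
   sign s of their first step. *)
pose s := bracket (eps g).
have s1 : s = 1 \/ s = -1 by rewrite /s; case: (eps g); [left|right].
have fwd q : (g' + q < n)%N -> 0 < s * weight B g' (g' + q).+1.
  elim: q => [|q IHq] hq.
    by rewrite addn0 weight_step1 // /s egg'; case: (eps g').
  have := IHq (ltnW (etrans (congr1 (fun m => m < n)%N (esym (addnS g' q))) hq)).
  have := no_q (inord (g' + q.+1).+1); rewrite inordK // ltnS leq_addr /=.
  rewrite (@weight_cat B g' (g' + q.+1) (g' + q.+1).+1) ?leq_addr // addnS.
  by have := weight_step_bound B (g' + q).+1; case: s1 => ->; slia.
have bwd q : (q <= g)%N -> 0 < s * weight B' (g - q) g'.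
  elim: q => [|q IHq] hq.
    by rewrite subn0 gS weight_step1 // /s; case: (eps g).
  have := IHq (ltnW hq).
  have qn : (g - q.+1 < n)%N by exact: leq_ltn_trans (leq_subr _ _) gn.
  have := no_q' (Ordinal qn); rewrite /= leq_subr /=.
  have gq : (g - q)%N = (g - q.+1).+1 by slia.
  rewrite gq (@weight_cat B' (g - q.+1) (g - q.+1).+1 g') //; last by slia.
  by have := weight_step_bound B' (g - q.+1); case: s1 => ->; slia.
have B0 : weight B 0 g' + weight B g' n = 0.
  by rewrite -(@weight_cat B 0 g' n) ?bP' // ltnW.
have B'0 : weight B' 0 g' + weight B' g' n = 0.
  by rewrite -(@weight_cat B' 0 g' n) ?bP' // ltnW.
have fn : 0 < s * weight B g' n.
  have := fwd (n - g'.+1)%N; rewrite (_ : (g' + (n - g'.+1)).+1 = n)%N; last slia.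
  by apply; slia.
have bn : 0 < s * weight B' 0 g' by have := bwd g; rewrite subnn; apply.
have nBB' : B != B'.
  by apply/eqP => BB'; move: fn bn B0; rewrite BB'; case: s1 => ->; slia.
have [i iB hi] : exists2 i, i \in B & (0 <= i < g')%N.
  by apply: weight_neq0; apply/eqP => w0; move: fn B0; rewrite w0; case: s1 => ->; slia.
have [l lB hl] : exists2 l, l \in B' & (g' <= l < n)%N.
  by apply: weight_neq0; apply/eqP => w0; move: bn B'0; rewrite w0; case: s1 => ->; slia.
have ig : i != g :> nat.
  by apply: contra nBB' => /eqP/val_inj ig; apply/eqP; apply: (tP B B' g) => //; rewrite -ig.
have lg : l != g' :> nat.
  by apply: contra nBB' => /eqP/val_inj lg; apply/eqP; apply: (tP B B' g') => //; rewrite -lg.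
by case/eqP: nBB'; apply: (ncP' B B' i g g' l) => //; slia.
Qed.

Lemma sum_mobius_balanced :
  \sum_(P | noncrossing P && bal P) mobius (@nc_le n) P [set [set: 'I_n]] = 0.
Proof.
apply: (@sum_mobius_fibres n _ (fun k : 'I_n.+1 * 'I_n.+1 => segment n k.1 k.2) _ level_pairs).
- exact: level_pairs_neq0.
- move=> P [a b] _ _ /level_pairsP[ab nab _ _ _] /=; split.
  + exact: convex_segment.
  + have an : (a < n)%N by have := ltn_ord b; slia.
    by apply/set0Pn; exists (Ordinal an); rewrite !inE /= leqnn ab.
  + apply: contra nab => /eqP J; have n0 : (0 < n)%N by have := ltn_ord g; slia.
    have := in_setT (Ordinal n0); have nn : (n.-1 < n)%N by slia.
    have := in_setT (Ordinal nn); rewrite -J !inE /=; have := ltn_ord b; slia.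
move=> P Q [a b] ncP ncQ bP kP /= sPQ.
have /level_pairsP[ab nab la lb hP] := kP.
have set0N R : noncrossing R -> set0 \notin R.
  by move=> /noncrossingP[/partition_setTP[]].
have bS : bal (cut_blocks (segment n a b) Q).
  rewrite sPQ (good_cut balanced_insertion) ?set0N // 1?ltnW // => B BP.
  by rewrite weight_segment hP.
have hQ B : B \in Q -> weight B a b = 0.
  by move=> BQ; apply/eqP; rewrite -weight_segment (cut_good_cap balanced_insertion bS).
have kQ : (a, b) \in level_pairs Q by apply/level_pairsP.
split; last by rewrite -(level_pairs_cut ncQ kQ) sPQ level_pairs_cut.
rewrite -(good_cut balanced_insertion (ltnW ab)) ?set0N // => B BQ.
by rewrite weight_segment hQ.
Qed.

End Adjacent.
End Balanced.

(** * Nested moments as moments of words *)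

Section LabelledWords.
Variables (L T : eqType) (good : pred (seq T)).
Hypothesis good_ins : insertion_invariant good.
Implicit Types (t u : seq (L * T)) (c d : L) (qs : seq (seq (L * T) * T)).

Definition labels t := [seq x.1 | x <- t].
Definition word t := [seq x.2 | x <- t].
Definition subword c t := [seq x.2 | x <- t & x.1 == c].
Definition blocks_good t := all (fun c => good (subword c t)) (labels t).

(** Two labels of a word cross if they alternate c, d, c, d in it. *)
Definition noncrossing_labels t : Prop :=
  forall c d, subseq [:: c; d; c; d] (labels t) -> c = d.

Lemma subword_notin c t : c \notin labels t -> subword c t = [::].
Proof.
move=> ct; rewrite /subword (eq_in_filter (a2 := pred0)) ?filter_pred0 //.
by move=> x xt; apply: contraNF ct => /eqP <-; exact: map_f.
Qed.

Lemma subword_cat c t u : subword c (t ++ u) = subword c t ++ subword c u.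
Proof. by rewrite /subword filter_cat map_cat. Qed.

Lemma blocks_goodP t : reflect (forall c, good (subword c t)) (blocks_good t).
Proof.
apply: (iffP allP) => [gt c|gt c _]; last exact: gt.
have [/gt//|/subword_notin->] := boolP (c \in labels t).
by case: good_ins.
Qed.

Lemma blocks_good_insert t v u :
  (forall c, c \in labels v -> c \notin labels (t ++ u)) ->
  blocks_good (t ++ v ++ u) = blocks_good v && blocks_good (t ++ u).
Proof.
move=> dis; have vE c : c \in labels v -> subword c (t ++ v ++ u) = subword c v.
  move=> /dis; rewrite /labels map_cat mem_cat negb_or => /andP[ct cu].
  by rewrite !subword_cat (subword_notin ct) (subword_notin cu) cats0.
have uE c : c \notin labels v -> subword c (t ++ v ++ u) = subword c (t ++ u).
  by move=> cv; rewrite !subword_cat (subword_notin cv).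
apply/blocks_goodP/andP => [g|[/blocks_goodP gv /blocks_goodP gu] c].
  split; apply/blocks_goodP => c; have [cv|ncv] := boolP (c \in labels v).
  - by rewrite -vE.
  - by rewrite subword_notin //; case: good_ins.
  - by rewrite subword_notin ?dis //; case: good_ins.
  - by rewrite -uE.
have [cv|ncv] := boolP (c \in labels v); first by rewrite vE.
by rewrite uE.
Qed.

(** The inverse of chop: its output, read again as a word. *)
Definition unchop c qs : seq (L * T) :=
  flatten [seq rcons q.1 (c, q.2) | q <- qs].

Lemma unchop_cons c q qs :
  unchop c (q :: qs) = q.1 ++ (c, q.2) :: unchop c qs.
Proof. by rewrite /unchop /= cat_rcons. Qed.

Lemma unchop_sub c q qs : q \in qs -> subseq q.1 (unchop c qs).
Proof.
elim: qs => // q' qs IHqs; rewrite inE unchop_cons => /orP[/eqP->|/IHqs sq].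
  exact: prefix_subseq.
by rewrite -cat_rcons; apply: subseq_trans sq (suffix_subseq _ _).
Qed.

Lemma noncrossing_labels_sub t u :
  subseq u t -> noncrossing_labels t -> noncrossing_labels u.
Proof.
move=> ut nct c d cd; apply: nct; apply: subseq_trans cd _.
exact: map_subseq.
Qed.

(** The labels of a segment between two letters of the block c occur nowhere else,
for they would cross c. The word p collects the letters of c already passed; it is
nonempty because the first letter of the whole word belongs to c. *)
Lemma blocks_good_unchop c p qs r : p != [::] ->
  noncrossing_labels ([seq (c, a) | a <- p] ++ unchop c qs ++ r) ->
  {in qs, forall q, c \notin labels q.1} -> c \notin labels r ->
  blocks_good ([seq (c, a) | a <- p] ++ unchop c qs ++ r) =
    [&& all (fun q => blocks_good q.1) qs, blocks_good r &
        good (p ++ [seq q.2 | q <- qs])].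
Proof.
elim: qs p => [|q qs IHqs] p p0 nc cq cr /=.
  rewrite -[r in LHS]cats0 blocks_good_insert; last first.
    move=> d dr; rewrite cats0 /labels -map_comp.
    by apply: contra cr => /mapP[a _ /= <-].
  rewrite !cats0; congr (_ && _); apply/blocks_goodP/idP => [/(_ c)|gp d].
    rewrite /subword filter_map /= (eq_filter (a2 := predT)) ?filter_predT.
      by rewrite -map_comp map_id.
    by move=> a /=; rewrite eqxx.
  rewrite /subword filter_map; have [<-|ncd] := eqVneq c d.
    rewrite (eq_filter (a2 := predT)) ?filter_predT => [|a /=]; last by rewrite eqxx.
    by rewrite -map_comp map_id.
  rewrite (eq_filter (a2 := pred0)) ?filter_pred0 => [|a /=]; first by case: good_ins.
  exact/negbTE.
rewrite unchop_cons -catA cat_cons in nc *.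
have ncq : c \notin labels q.1 by apply: cq; rewrite mem_head.
rewrite blocks_good_insert; last first.
  move=> d dq; have dc : d != c by apply: contraNneq ncq => <-.
  rewrite /labels map_cat mem_cat negb_or -map_comp; apply/andP; split.
    by apply: contra dc => /mapP[a _ ->].
  rewrite /= inE negb_or dc /=; apply/negP => dr.
  case/eqP: dc; apply/esym/nc; rewrite /labels map_cat -map_comp.
  case: p p0 {nc} => //= a p _; rewrite eqxx /= -cat1s.
  apply: (@cat_subseq _ [::] [:: d; c; d]); first exact: sub0seq.
  rewrite map_cat; apply: (@cat_subseq _ [:: d]); first by rewrite sub1seq.
  by rewrite /= eqxx sub1seq.
rewrite -andbA; congr (_ && _).
rewrite -cat_rcons -map_rcons IHqs ?cat_rcons //.
- by rewrite -size_eq0 size_rcons.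
- apply: noncrossing_labels_sub nc; rewrite map_rcons cat_rcons.
  by apply: cat_subseq => //; exact: suffix_subseq.
- by move=> q' q'q; apply: cq; rewrite inE q'q orbT.
Qed.

Lemma good_unchop c p qs r : {in qs, forall q, good (word q.1)} ->
  good (word r) ->
  good (p ++ word (unchop c qs ++ r)) = good (p ++ [seq q.2 | q <- qs]).
Proof.
have [_ gi] := good_ins; elim: qs p => [|q qs IHqs] p gq gr /=.
  by rewrite -[word r]cats0 gi.
rewrite unchop_cons /word -catA map_cat /= gi ?gq ?mem_head //.
rewrite -!cat_rcons -IHqs // => q' q'q; apply: gq; rewrite inE q'q orbT //.
Qed.

End LabelledWords.

Section NestedMoments.
Variables (A : pzRingType) (E : A -> A) (T : eqType) (val : T -> A).
Variables (good : pred (seq T)) (M : A -> Prop).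
Hypothesis good_ins : insertion_invariant good.

Definition wprod (u : seq T) : A := \prod_(a <- u) val a.

Definition moment (u : seq T) : A := if u is [::] then 1 else E (wprod u).

(* M is a multiplicative set on which the hypotheses on E are available: good words
   may be replaced by their moments inside E, or pulled out of E on the right. *)
Hypotheses (M1 : M 1) (MM : forall x y, M x -> M y -> M (x * y)).
Hypothesis Mval : forall a, M (val a).
Hypothesis Mmoment : forall u, good u -> M (moment u).
Hypothesis E0 : E 0 = 0.
Hypothesis E_good : forall x y v, M x -> M y -> good v ->
  E (x * moment v * y) = E (x * wprod v * y).
Hypothesis EM_good : forall u v, u != [::] -> good v ->
  E (wprod u) * moment v = E (wprod (u ++ v)).
Hypothesis E_bad : forall u, u != [::] -> ~~ good u -> E (wprod u) = 0.

Section Labels.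
Variable L : eqType.
Implicit Types (t r : seq (L * T)) (qs : seq (seq (L * T) * T)).

Let value (x : L * T) : L * A := (x.1, val x.2).

Lemma chopP c t : exists qs r,
  [/\ chop c (map value t) = ([seq (map value q.1, val q.2) | q <- qs], map value r),
      t = unchop c qs ++ r,
      {in qs, forall q, c \notin labels q.1} & c \notin labels r].
Proof.
elim: t => [|[c' a] t [qs [r [tE tD cq cr]]]] /=; first by exists [::], [::].
rewrite tE {1}tD {tE tD}; have [->|nc] := eqVneq c' c.
  exists (([::], a) :: qs), r; split=> //.
  by move=> q; rewrite inE => /orP[/eqP->|/cq].
have cc' : c != c' by rewrite eq_sym.
case: qs cq => [|q qs] cq /=.
  by exists [::], ((c', a) :: r); split=> //; rewrite /= inE negb_or cc'.
exists (((c', a) :: q.1, q.2) :: qs), r; split=> //.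
move=> q'; rewrite inE => /orP[/eqP->|q'q]; last by apply: cq; rewrite inE q'q orbT.
by rewrite /= inE negb_or cc' cq ?mem_head.
Qed.

Lemma M_wprod u : M (wprod u).
Proof.
elim: u => [|a u IHu]; first by rewrite /wprod big_nil.
by rewrite /wprod big_cons; apply: MM.
Qed.

Lemma wprod_cat u v : wprod (u ++ v) = wprod u * wprod v.
Proof. by rewrite /wprod big_cat. Qed.

Lemma E_unchop c qs x : M x -> {in qs, forall q, good (word q.1)} ->
  E (x * \prod_(q <- qs) (moment (word q.1) * val q.2)) =
  E (x * wprod (word (unchop c qs))).
Proof.
elim: qs x => [|q qs IHqs] x Mx gq; first by rewrite /unchop /wprod !big_nil.
have gqs : {in qs, forall q, good (word q.1)}.
  by move=> q' q'q; apply: gq; rewrite inE q'q orbT.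
rewrite big_cons -mulrA mulrA E_good ?gq ?mem_head //; last first.
  apply: MM => //; rewrite big_seq; elim/big_rec: _ => // q' y q'q My.
  by apply: MM => //; apply: MM => //; apply: Mmoment; exact: gqs.
rewrite unchop_cons /word map_cat wprod_cat /=.
rewrite /(wprod (q.2 :: _)) big_cons !mulrA -IHqs //.
by apply: MM => //; apply: MM => //; exact: M_wprod.
Qed.

(** The segments between the letters of the first block contribute their moments by
induction, or 0 if one of their blocks is bad; E_good puts the segments back in
place of their moments, so that the first block contributes the moment of a
contiguous word, which is 0 if this block is bad. The second claim is what makes
E_good applicable to the segments. *)
Lemma nested_momentE k t : (size t <= k)%N -> noncrossing_labels t ->
  nested_moment E k (map value t) =
    (if blocks_good good t then moment (word t) else 0)
  /\ (blocks_good good t -> good (word t)).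
Proof.
have [g0 gi] := good_ins.
elim: k t => [|k IHk] [|[c a] t] //= tk nct.
have [qs [r [-> tE cq cr]]] := chopP c t.
have subq q : q \in qs -> subseq q.1 t.
  by move=> qqs; rewrite tE; apply: subseq_trans (unchop_sub c qqs) (prefix_subseq _ _).
have subr : subseq r t by rewrite tE suffix_subseq.
have ncs u : subseq u t -> noncrossing_labels u.
  by move=> ut; apply: noncrossing_labels_sub nct; exact: subseq_trans (subseq_cons _ _).
have szs u : subseq u t -> (size u <= k)%N.
  by move=> ut; rewrite -ltnS; apply: leq_ltn_trans tk; exact: size_subseq.
have IHq q : q \in qs -> nested_moment E k (map value q.1) =
    (if blocks_good good q.1 then moment (word q.1) else 0)
    /\ (blocks_good good q.1 -> good (word q.1)).
  by move=> /subq sq; apply: IHk; [exact: szs | exact: ncs].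
have [IHr gr] := IHk r (szs _ subr) (ncs _ subr).
have nct' : noncrossing_labels ([seq (c, a) | a <- [:: a]] ++ unchop c qs ++ r).
  by rewrite -tE.
have := blocks_good_unchop good_ins (isT : [:: a] != [::]) nct' cq cr.
rewrite -tE /= => ->; rewrite IHr big_map /=.
have [/allP gqs|/allPn[q qqs bq]] /= := boolP (all _ qs); last first.
  split=> //; rewrite [X in E (_ * X)](_ : _ = 0) ?mulr0 ?E0 ?mul0r //.
  case: (path.splitPr qqs) => qs1 qs2; rewrite big_cat big_cons /=.
  by rewrite (IHq q qqs).1 (negbTE bq) !mul0r mulr0.
have gq : {in qs, forall q, good (word q.1)}.
  by move=> q qqs; apply: (IHq q qqs).2; exact: gqs.
have [bgr|] := boolP (blocks_good good r); last by rewrite mulr0.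
have -> : \prod_(q <- qs) (nested_moment E k (map value q.1) * val q.2) =
          \prod_(q <- qs) (moment (word q.1) * val q.2).
  by apply: eq_big_seq => q qqs; rewrite (IHq q qqs).1 gqs.
rewrite (E_unchop c) // -[val a * _](big_cons 1 *%R a _ predT val) -/(wprod _).
have gw u : good u -> good (a :: word (unchop c qs) ++ u) = good (a :: [seq q.2 | q <- qs]).
  move=> gu; have := @good_unchop _ _ _ good_ins c [:: a] qs [::] gq g0.
  rewrite cats0 /= => <-; rewrite -[u]cats0 -cat_cons gi //.
  by rewrite cats0.
rewrite /= -(gw [::] g0) cats0; case: ifP => [gb|/negbT bb]; split=> //.
- by rewrite EM_good ?gr //= [in RHS]tE /word map_cat.
- by move=> _; rewrite tE /word map_cat gw ?gr // -(gw [::] g0) cats0.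
- by rewrite E_bad ?mul0r.
Qed.

End Labels.

Lemma labelled_noncrossing n (P : {set {set 'I_n}}) (a : 'I_n -> T) :
  noncrossing P ->
  noncrossing_labels [seq (pblock P i, a i) | i <- enum 'I_n].
Proof.
move=> /noncrossingP[pP ncP] c d; rewrite /labels -map_comp => /subseqP[m _].
rewrite -map_mask => cdE.
have : sorted (fun i j : 'I_n => (i < j)%N) (mask m (enum 'I_n)).
  apply: sorted_mask => [i j k|]; first exact: ltn_trans.
  by have := iota_ltn_sorted 0 n; rewrite -val_enum_ord sorted_map.
have inP i : i \in cover P by have /and3P[/eqP-> _ _] := pP; rewrite inE.
case: (mask m _) cdE => [|i [|j [|k [|l [|]]]]] //= [cE dE cE' dE'].
case/and4P=> ij jk kl _; apply: (ncP c d i j k l) => //.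
- by rewrite cE pblock_mem.
- by rewrite dE pblock_mem.
- by rewrite cE mem_pblock.
- by rewrite dE mem_pblock.
- by rewrite cE' mem_pblock.
- by rewrite dE' mem_pblock.
Qed.

Lemma blocks_good_labelled n (P : {set {set 'I_n}}) (a : 'I_n -> T) :
  partition P [set: 'I_n] ->
  blocks_good good [seq (pblock P i, a i) | i <- enum 'I_n] = good_part a good P.
Proof.
move=> pP; have /partition_setTP[P0 cP tP] := pP.
have /and3P[/eqP covP trP _] := pP.
have sub B : B \in P ->
    subword B [seq (pblock P i, a i) | i <- enum 'I_n] = block_word a B.
  move=> BP; rewrite /subword filter_map -map_comp /block_word.
  rewrite (_ : enum B = [seq i <- enum 'I_n | i \in B]); last first.
    by rewrite {1}/enum_mem -enumT.
  congr map; apply: eq_filter => i /=; apply/eqP/idP => [<-|iB].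
    by rewrite mem_pblock covP inE.
  exact: def_pblock.
apply/(blocks_goodP good_ins)/forall_inP => [g B BP|g c]; first by rewrite -sub.
have [cl|/subword_notin->] := boolP (c \in labels [seq (pblock P i, a i) | i <- enum 'I_n]).
  have cP' : c \in P.
    by move: cl; rewrite /labels -map_comp => /mapP[i _ ->]; rewrite pblock_mem // covP inE.
  by rewrite sub // g.
by case: good_ins.
Qed.

Lemma hatE_good n (P : {set {set 'I_n}}) (a : 'I_n -> T) : noncrossing P ->
  hatE E P (fun i => val (a i)) =
  if good_part a good P then moment [seq a i | i <- enum 'I_n] else 0.
Proof.
move=> ncP; have /noncrossingP[pP _] := ncP.
rewrite -blocks_good_labelled //.
have [] := @nested_momentE _ n [seq (pblock P i, a i) | i <- enum 'I_n].
- by rewrite size_map size_enum_ord.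
- exact: labelled_noncrossing.
rewrite /hatE -map_comp => -> _; congr (if _ then moment _ else _).
exact/esym/map_comp.
Qed.

Lemma cumulant_good n (a : 'I_n -> T) :
  cumulant E (fun i => val (a i)) =
  moment [seq a i | i <- enum 'I_n] *~
    \sum_(P | noncrossing P && good_part a good P)
       mobius (@nc_le n) P [set [set: 'I_n]].
Proof.
rewrite /cumulant mulrz_sumr [RHS]big_mkcondr; apply: eq_bigr => P ncP.
by rewrite hatE_good //; case: ifP => // _; rewrite mul0rz.
Qed.

End NestedMoments.

(** * Bounded operators in coordinates *)

From mathcomp Require Import boolp classical_sets topology normedtype sequences.

Import numFieldNormedType.Exports.
Local Open Scope classical_set_scope.

Section Operators.
Variables (R : realType) (X : countType).
Local Notation C := R[i].
Implicit Types (S T : bop R X) (f g : l2 R X) (c : C).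

Lemma bop_addE S T f x : (S + T) f x = S f x + T f x.
Proof. by []. Qed.

Lemma bop_scaleE c T f x : (c *: T) f x = c * T f x.
Proof. by []. Qed.

Lemma bop_mulE S T f : (S * T) f = S (T f).
Proof. by []. Qed.

Lemma bop_zeroE f : (0 : bop R X) f = 0.
Proof. by []. Qed.

Lemma bop_scale_l2 T c f : T (c *: f) = c *: T f.
Proof.
have h := bop_linear T; have T0 : T 0 = 0.
  have := h 1 0 0; rewrite !scale1r addr0 => /eqP.
  by rewrite -subr_eq0 opprD addrA subrr sub0r oppr_eq0 => /eqP.
by have := h c f 0; rewrite !addr0 T0 addr0.
Qed.

Lemma bop_l2_zero T : T 0 = 0.
Proof. by rewrite -[X in T X = _](scale0r (0 : l2 R X)) bop_scale_l2 scale0r. Qed.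

Lemma bop_scaleAl c S T : (c *: S) * T = c *: (S * T).
Proof. exact: bopP. Qed.

Lemma bop_scaleAr c S T : S * (c *: T) = c *: (S * T).
Proof.
apply: bopP => f x.
exact: (congr1 (fun g : l2 R X => g x) (bop_scale_l2 S c (T f))).
Qed.

Lemma inner_xi f u : inner f (xi u) = f u.
Proof.
pose t k : C := oapp (fun x => f x * conjc (xi u x)) 0 (pickle_inv k).
have -> : inner f (xi u) =
    Complex (limn (fun N => \sum_(0 <= k < N) complex.Re (t k)))
            (limn (fun N => \sum_(0 <= k < N) complex.Im (t k))) by [].
have tE k : t k = if k == pickle u then f u else 0.
  rewrite /t; case: eqVneq => [->|ku].
    by rewrite pickleK_inv /= eqxx conjc1 mulr1.
  case kE : (pickle_inv k) => [x|] //=.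
  have [xu|] := eqVneq x u; last by rewrite conjc0 mulr0.
  by have := @pickle_invK X k; rewrite kE xu /= => kk; rewrite -kk eqxx in ku.
have sumE (F : C -> R) : F 0 = 0 -> limn (fun N => \sum_(0 <= k < N) F (t k)) = F (f u).
  move=> F0; apply: cvg_lim => //; apply: cvg_near_cst.
  exists (pickle u).+1 => //= N uN.
  rewrite (bigD1_seq (pickle u)) ?mem_index_iota ?iota_uniq //= tE eqxx.
  by rewrite big1_seq ?addr0 // => k /andP[ku _]; rewrite tE (negbTE ku).
by rewrite !sumE //; case: (f u).
Qed.

Lemma inner0 f : inner 0 f = 0 :> C.
Proof.
pose t k : C := oapp (fun x => (0 : l2 R X) x * conjc (f x)) 0 (pickle_inv k).
have -> : inner 0 f =
    Complex (limn (fun N => \sum_(0 <= k < N) complex.Re (t k)))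
            (limn (fun N => \sum_(0 <= k < N) complex.Im (t k))) by [].
have t0 k : t k = 0 by rewrite /t; case: (pickle_inv k) => //= x; rewrite mul0r.
by congr Complex; apply: cvg_lim => //; apply: cvg_near_cst; apply: nearW => N;
  rewrite big1 // => k _; rewrite t0.
Qed.

Lemma sub_wot_closure (S : set (bop R X)) : S `<=` wot_closure S.
Proof.
move=> T ST s e e0; exists T => // p _.
by rewrite subrr bop_zeroE inner0 ComplexField.Normc.normc0.
Qed.

(** Testing against basis vectors on one side only: the coordinates of a weak limit
are limits of coordinates, simultaneously for finitely many vectors. *)
Lemma wot_closure_coord (S : set (bop R X)) T : wot_closure S T ->
  forall (s : seq (l2 R X * X)) (e : R), 0 < e -> exists2 T0, S T0 &
    forall p, p \in s -> ComplexField.Normc.normc (T p.1 p.2 - T0 p.1 p.2) < e.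
Proof.
move=> ST s e e0; have [T0 ST0 T0e] := ST [seq (p.1, xi p.2) | p <- s] e e0.
exists T0 => // -[f u] ps /=.
have <- : inner ((T - T0) f) (xi u) = T f u - T0 f u by rewrite inner_xi.
by apply: (T0e (f, xi u)); apply/mapP; exists (f, u).
Qed.

End Operators.

(** * Products of the operators of a graph *)

Lemma normc_ge0 (R : realType) (z : R[i]) : 0 <= ComplexField.Normc.normc z.
Proof. by case: z => a b; exact: sqrtr_ge0. Qed.

Section GraphOperators.
Variables (R : realType) (G : digraph).
Local Notation B := (bop R (fsgd G)).
Local Notation C := R[i].
Implicit Types (S T : B) (f : l2 R (fsgd G)) (u h p q : fsgd G) (v : vertex G).
Local Notation Lv v := (L R (vtx v)).

Lemma fsgd_eq u h : source u = source h -> edges u = edges h -> u = h.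
Proof.
move=> suh euh; apply/val_inj.
by rewrite [val u]surjective_pairing [val h]surjective_pairing; congr pair.
Qed.

Lemma concat_some p q : target p = source q ->
  exists r, [/\ concat p q = Some r, source r = source p,
                edges r = edges p ++ edges q & target r = target q].
Proof.
move=> pq; have adm : admissible (source p) (edges p ++ edges q).
  rewrite admissible_cat (valP p : admissible (source p) _) /= -/(target p) pq.
  exact: (valP q).
exists (exist _ (source p, edges p ++ edges q) adm); split=> //.
  by rewrite /concat pq eqxx; apply/insub_fsgd.
rewrite /target /edges /source /= map_cat last_cat.
by rewrite -/(edges p) -/(source p) -/(target p) pq.
Qed.

Lemma concat_none p q : target p != source q -> concat p q = None.
Proof. by rewrite /concat => /negbTE ->. Qed.

Lemma concatA p q u :
  obind (concat p) (concat q u) = obind (fun r => concat r u) (concat p q).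
Proof.
have [qu|qu] := eqVneq (target q) (source u); last first.
  rewrite (concat_none qu) /=.
  have [pq|pq] := eqVneq (target p) (source q); last by rewrite concat_none.
  by have [r [-> _ _ rq]] := concat_some pq; rewrite /= concat_none // rq.
have [r [-> sr er tr]] := concat_some qu.
have [pq|pq] := eqVneq (target p) (source q); last first.
  by rewrite (concat_none pq) /= concat_none // sr.
have [t [-> st et tt]] := concat_some pq.
have [r1 [/= -> s1 e1 _]] := concat_some (etrans pq (esym sr)).
have [r2 [-> s2 e2 _]] := concat_some (etrans tt qu).
by congr Some; apply: fsgd_eq; rewrite ?s1 ?s2 ?st // e1 e2 er et catA.
Qed.

Lemma ldivA p q u :
  obind (ldiv q) (ldiv p u) = obind (fun r => ldiv r u) (concat p q).
Proof.
have ext (a b : option (fsgd G)) : (forall k, a = Some k <-> b = Some k) -> a = b.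
  by case: a b => [k|] [k'|] // ab; [exact/ab | case: ((ab k).1 erefl)
    | case: ((ab k').2 erefl)].
apply: ext => k; split.
  case hE : (ldiv p u) => [h|] //= /ldivP kE; move/ldivP: hE => hE.
  have := concatA p q k; rewrite kE /= hE.
  by case: (concat p q) => //= r rE; apply/ldivP.
case rE : (concat p q) => [r|] //= /ldivP kE.
have := concatA p q k; rewrite rE /= kE.
case hE : (concat q k) => [h|] //= hu.
by rewrite (proj2 (ldivP _ _ _) hu) /=; apply/ldivP.
Qed.

Lemma concat_vtx v u : concat (vtx v) u = if source u == v then Some u else None.
Proof.
rewrite eq_sym; case: eqVneq => [vu|vu]; last exact: concat_none.
have [r [-> sr er _]] := concat_some (vu : target (vtx v) = source u).
by congr Some; apply: fsgd_eq; rewrite ?sr // er.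
Qed.

Lemma ldiv_vtx v u : ldiv (vtx v) u = if source u == v then Some u else None.
Proof.
have := concat_vtx v u; case: eqVneq => [uv|uv] cE; first exact/ldivP.
case hE : (ldiv (vtx v) u) => [h|] //; have /ldivP := hE.
by rewrite concat_vtx; case: eqP => // hv [hu]; rewrite -hu hv eqxx in uv.
Qed.

Lemma LvE v f u : Lv v f u = if source u == v then f u else 0.
Proof. by rewrite [LHS]/= ldiv_vtx; case: ifP. Qed.

Lemma L_mul p q : L R p * L R q = oapp (@L R G) 0 (concat p q).
Proof.
apply: bopP => f u; transitivity (oapp f 0 (obind (ldiv q) (ldiv p u))).
  by rewrite /=; case: (ldiv p u).
by rewrite ldivA; case: (concat p q).
Qed.

Lemma Lstar_mul p q : Lstar R p * Lstar R q = oapp (@Lstar R G) 0 (concat q p).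
Proof.
apply: bopP => f u; transitivity (oapp f 0 (obind (concat q) (concat p u))).
  by rewrite /=; case: (concat p u).
by rewrite concatA; case: (concat q p).
Qed.

Lemma Lstar_vtx v : Lstar R (vtx v) = Lv v.
Proof. by apply: bopP => f u; rewrite LvE /= concat_vtx; case: ifP. Qed.

Lemma concat_vtxr p v : concat p (vtx v) = if target p == v then Some p else None.
Proof.
case: eqVneq => [pv|pv]; last exact: concat_none.
have [r [-> sr er _]] := concat_some (pv : target p = source (vtx v)).
by congr Some; apply: fsgd_eq; rewrite ?sr // er cats0.
Qed.

Lemma Lv_L v p : Lv v * L R p = if source p == v then L R p else 0.
Proof. by rewrite L_mul concat_vtx; case: ifP. Qed.

Lemma L_Lv v p : L R p * Lv v = if target p == v then L R p else 0.
Proof. by rewrite L_mul concat_vtxr; case: ifP. Qed.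

Lemma Lv_Lstar v p : Lv v * Lstar R p = if target p == v then Lstar R p else 0.
Proof. by rewrite -Lstar_vtx Lstar_mul concat_vtxr; case: ifP. Qed.

Lemma Lstar_Lv v p : Lstar R p * Lv v = if source p == v then Lstar R p else 0.
Proof. by rewrite -Lstar_vtx Lstar_mul concat_vtx; case: ifP. Qed.

Definition diagonal T : Prop := forall f u, T f u = vcoef T (source u) * f u.

Lemma vcoefE T (d : vertex G -> C) :
  (forall f u, T f u = d (source u) * f u) -> forall v, vcoef T v = d v.
Proof. by move=> Td v; rewrite /vcoef Td /= eqxx mulr1. Qed.

(** Elements of the algebra generated by the L_v multiply the coordinate at u by a
scalar depending on the source of u only. As this scalar is itself a coordinate, at a
vertex, the property passes to weak limits. *)
Lemma DG_diagonal T : DG T -> diagonal T.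
Proof.
have gen S : generated_algebra [set T | exists v, T = Lv v] S -> diagonal S.
  elim=> [|_ [v ->]|S1 S2 _ h1 _ h2|c S1 _ h1|S1 S2 _ h1 _ h2] f u.
  - by rewrite /vcoef !bop_zeroE !mul0r.
  - by rewrite vcoef_L LvE; case: eqVneq => [->|uv]; rewrite ?eqxx ?mul1r //;
      case: eqVneq => [[vu]|]; rewrite ?mul0r //; rewrite vu eqxx in uv.
  - rewrite (@vcoefE _ (fun v => vcoef S1 v + vcoef S2 v)) ?bop_addE ?h1 ?h2 ?mulrDl //.
    by move=> f' u'; rewrite bop_addE h1 h2 mulrDl.
  - rewrite (@vcoefE _ (fun v => c * vcoef S1 v)) ?bop_scaleE ?h1 ?mulrA //.
    by move=> f' u'; rewrite bop_scaleE h1 mulrA.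
  - rewrite (@vcoefE _ (fun v => vcoef S1 v * vcoef S2 v)).
      by rewrite bop_mulE h1 h2 mulrA.
    by move=> f' u'; rewrite bop_mulE h1 h2 mulrA.
move=> /wot_closure_coord DT f u; apply/eqP; rewrite -subr_eq0; apply/eqP.
apply: ComplexField.Normc.eq0_normc.
set z := _ - _; have [//|z0] := eqVneq (ComplexField.Normc.normc z) 0.
pose N := ComplexField.Normc.normc (f u).
have N0 : 0 <= N by exact: normc_ge0.
have zpos : 0 < ComplexField.Normc.normc z.
  by rewrite lt_neqAle eq_sym z0 normc_ge0.
(* With this tolerance the errors made on T f u and on vcoef T times f u add up to
   less than the modulus of z. *)
have e0 : 0 < ComplexField.Normc.normc z / (1 + N).
  by rewrite divr_gt0 // ltr_pwDl.
have [T0 /gen T0d T0e] := DT [:: (f, u); (xi (vtx (source u)), vtx (source u))] _ e0.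
have := T0e (f, u); rewrite mem_head => /(_ isT) /= h1.
have := T0e (xi (vtx (source u)), vtx (source u)).
rewrite !inE eqxx orbT => /(_ isT) /= h2.
have zE : z = (T f u - T0 f u) - (vcoef T (source u) - vcoef T0 (source u)) * f u.
  by rewrite T0d /z mulrBl opprB addrA subrK.
have : ComplexField.Normc.normc z < ComplexField.Normc.normc z / (1 + N) * (1 + N).
  rewrite {1}zE mulrDr mulr1; apply: le_lt_trans (le_normcD _ _) _.
  rewrite normcN ComplexField.Normc.normcM.
  by rewrite ltr_leD // ler_wpM2r // ltW.
by rewrite divfK ?ltxx // gt_eqF // ltr_pwDl.
Qed.

End GraphOperators.

(** * Words in L_w and its adjoint under an expectation *)

Section Expectation.
Variables (R : realType) (G : digraph) (w : fsgd G).
Local Notation B := (bop R (fsgd G)).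
Local Notation C := R[i].
Local Notation Lv v := (L R (vtx v)).
Implicit Types (S T : B) (e : bool) (u : seq bool) (v : vertex G).

Definition letter e : B := if e then L R w else Lstar R w.

(** L_v is a left unit of the letter e for v = [lsupp e], and a right unit for
v = [lsupp (~~ e)]. *)
Definition lsupp e : vertex G := if e then source w else target w.

Definition letters u : B := \prod_(e <- u) letter e.

Lemma Lv_letter v e : Lv v * letter e = if lsupp e == v then letter e else 0.
Proof. by case: e; [exact: Lv_L | exact: Lv_Lstar]. Qed.

Lemma letter_Lv v e : letter e * Lv v = if lsupp (~~ e) == v then letter e else 0.
Proof. by case: e; [exact: L_Lv | exact: Lstar_Lv]. Qed.

Lemma Lv_letters e u : Lv (lsupp e) * letters (e :: u) = letters (e :: u).
Proof. by rewrite /letters big_cons mulrA Lv_letter eqxx. Qed.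

Lemma letters_Lv e u :
  letters (rcons u e) * Lv (lsupp (~~ e)) = letters (rcons u e).
Proof.
by rewrite /letters -cats1 big_cat /= big_seq1 -mulrA letter_Lv eqxx.
Qed.

Lemma letters_cat u1 u2 : letters (u1 ++ u2) = letters u1 * letters u2.
Proof. by rewrite /letters big_cat. Qed.

(** After a cancellation the remaining L_v is absorbed by a neighbouring letter, or
is orthogonal to it. *)
Lemma letters_remove u1 v u2 : u1 ++ u2 != [::] ->
  letters u1 * Lv v * letters u2 = letters (u1 ++ u2) \/
  letters u1 * Lv v * letters u2 = 0.
Proof.
case: u2 => [|e u2].
  rewrite cats0; case/lastP: u1 => // u1 e _.
  rewrite /letters big_nil mulr1 -cats1 big_cat /= big_seq1 -mulrA letter_Lv.
  by case: ifP => _; rewrite ?mulr0; [left|right].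
move=> _; rewrite /letters big_cons big_cat big_cons -mulrA (mulrA (Lv v)) Lv_letter.
by case: ifP => _; rewrite ?mul0r ?mulr0; [left|right].
Qed.

(** The first algebra lies in W*(G), where a conditional expectation is linear and a
bimodule map; the second one provides the outer factors of the range rule. *)
Definition evaluable : set B := fun T =>
  generated_algebra [set T | exists p : fsgd G, T = L R p \/ T = Lstar R p] T /\
  generated_algebra [set T | [\/ @DG R G T, T = L R w | T = Lstar R w]] T.

(** The identity operator is the empty word, but need not be in either algebra. *)
Definition factor : set B := fun T => T = 1 \/ evaluable T.

Lemma evaluable0 : evaluable 0. Proof. by split; exact: Gen_0. Qed.

Lemma evaluableM S T : evaluable S -> evaluable T -> evaluable (S * T).
Proof. by move=> [S1 S2] [T1 T2]; split; exact: Gen_mul. Qed.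

Lemma evaluableZ c T : evaluable T -> evaluable (c *: T).
Proof. by move=> [T1 T2]; split; exact: Gen_scale. Qed.

Lemma evaluable_Lv v : evaluable (Lv v).
Proof.
split; apply: Gen_in; first by exists (vtx v); left.
by apply: Or31; apply: sub_wot_closure; apply: Gen_in; exists v.
Qed.

Lemma evaluable_letter e : evaluable (letter e).
Proof.
split; apply: Gen_in; first by exists w; case: e; [left|right].
by case: e; [apply: Or32 | apply: Or33].
Qed.

Lemma factorM S T : factor S -> factor T -> factor (S * T).
Proof.
case=> [->|pS]; first by rewrite mul1r.
by case=> [->|pT]; rewrite ?mulr1; right => //; exact: evaluableM.
Qed.

Lemma factor_between S T S' : factor S -> evaluable T -> factor S' ->
  evaluable (S * T * S').
Proof.
move=> fS pT fS'; have pST : evaluable (S * T).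
  by case: fS => [->|pS]; rewrite ?mul1r //; exact: evaluableM.
by case: fS' => [->|pS']; rewrite ?mulr1 //; exact: evaluableM.
Qed.

Lemma factor_letters u : factor (letters u).
Proof.
rewrite /letters; elim/big_rec: _ => [|e T _ fT]; first by left.
by apply: factorM => //; right; exact: evaluable_letter.
Qed.

Variables (E : B -> B) (good : pred (seq bool)).
Hypothesis good_ins : insertion_invariant good.
Hypothesis E_scale : forall c T, evaluable T -> E (c *: T) = c *: E T.
Hypothesis E_bimodule : forall v v' T, evaluable T ->
  E (Lv v * T * Lv v') = Lv v * E T * Lv v'.
Hypothesis E_Lv : forall v, E (Lv v) = Lv v.

(** Not an identity of operators for e = true, where it expresses the range rule. *)
Definition cancels e : Prop := forall S S', factor S -> factor S' ->
  E (S * (letter e * letter (~~ e)) * S') = E (S * Lv (lsupp e) * S').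

Hypothesis reduction : forall u, u != [::] ->
  (exists u1 e u2, [/\ u = u1 ++ [:: e; ~~ e] ++ u2, good [:: e; ~~ e] & cancels e])
  \/ ~~ good u /\ E (letters u) = 0.

Lemma E_zero : E 0 = 0.
Proof. by rewrite -[0 in LHS](scale0r (0 : B)) E_scale ?scale0r //; exact: evaluable0. Qed.

(** Cancel adjacent letters as long as possible; goodness does not change. The L_v
left by a cancellation is absorbed or kills the word by [letters_remove], except for
the last one when the whole word cancels, which happens only to good words. A
nonempty word in which nothing cancels is not good and has expectation 0. *)
Lemma E_letters u : u != [::] ->
  (good u -> exists2 d, d = 0 \/ (exists v, d = Lv v) &
     forall S S', factor S -> factor S' -> E (S * letters u * S') = E (S * d * S'))
  /\ (~~ good u -> E (letters u) = 0).
Proof.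
have [g0 gi] := good_ins; have [n] := ubnP (size u).
elim: n u => // n IHn u un u0.
have [[u1 [e [u2 [uE ge ce]]]]|[ngu Eu]] := reduction u0; last first.
  by split=> //; rewrite (negbTE ngu).
have step S S' : factor S -> factor S' -> E (S * letters u * S') =
    E (S * (letters u1 * Lv (lsupp e) * letters u2) * S').
  move=> fS fS'; rewrite uE !letters_cat.
  have := ce (S * letters u1) (letters u2 * S').
  rewrite (_ : letters [:: e; ~~ e] = letter e * letter (~~ e)); last first.
    by rewrite /letters big_cons big_seq1.
  rewrite !mulrA; apply.
    by apply: factorM => //; exact: factor_letters.
  by apply: factorM => //; exact: factor_letters.
have gE : good u = good (u1 ++ u2) by rewrite uE gi.
have [u12|u12] := eqVneq (u1 ++ u2) [::].
  split=> [_|]; last by rewrite gE u12 g0.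
  exists (Lv (lsupp e)); first by right; exists (lsupp e).
  move=> S S' fS fS'; rewrite step //.
  by case: u1 u2 u12 {uE step gE} => [|//] [|//] _; rewrite /letters big_nil mul1r mulr1.
have [|IH1 IH2] := IHn (u1 ++ u2) _ u12.
  by move: un; rewrite uE !size_cat /=; lia.
have [lE|l0] := letters_remove (lsupp e) u12.
  split=> [gu|ngu].
    have [d dE Ed] := IH1 (etrans (esym gE) gu); exists d => // S S' fS fS'.
    by rewrite step // lE Ed.
  rewrite -[letters u]mul1r -[1 * _]mulr1 step; try by left.
  by rewrite mul1r mulr1 lE IH2 // -gE.
split=> [gu|ngu].
  by exists 0; [left | move=> S S' fS fS'; rewrite step // l0].
rewrite -[letters u]mul1r -[1 * _]mulr1 step; try by left.
by rewrite l0 mulr0 mul0r E_zero.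
Qed.

Definition scaled_letter (a : C * bool) : B := a.1 *: letter a.2.

Local Notation moment := (moment E scaled_letter).
Implicit Types (x y : seq (C * bool)).

Lemma wprod_scaled x :
  wprod scaled_letter x = (\prod_(a <- x) a.1) *: letters [seq a.2 | a <- x].
Proof.
elim: x => [|a x IHx]; first by rewrite /wprod /letters !big_nil scale1r.
rewrite /wprod /letters !big_cons -/(wprod _ x) IHx /scaled_letter.
by rewrite bop_scaleAl bop_scaleAr scalerA /letters.
Qed.

Lemma evaluable_letters u : u != [::] -> evaluable (letters u).
Proof.
case: u => // e u _; rewrite /letters big_cons -[X in evaluable X]mul1r mulrA.
by apply: factor_between; [left | exact: evaluable_letter | exact: factor_letters].
Qed.

Lemma evaluable_wprod x : x != [::] -> evaluable (wprod scaled_letter x).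
Proof.
case: x => // a x _; rewrite wprod_scaled; apply: evaluableZ.
exact: evaluable_letters.
Qed.

Let goodx : pred (seq (C * bool)) := fun x => good [seq a.2 | a <- x].

Lemma goodx_ins : insertion_invariant goodx.
Proof.
have [g0 gi] := good_ins; split=> // x y z; rewrite /goodx !map_cat.
exact: gi.
Qed.

Lemma moment_good x : x != [::] -> goodx x ->
  (exists c d, [/\ moment x = c *: d, d = 0 \/ exists v, d = Lv v &
     forall S S', factor S -> factor S' ->
       E (S * wprod scaled_letter x * S') = c *: E (S * d * S')]).
Proof.
move=> x0 gx; have u0 : [seq a.2 | a <- x] != [::] by case: x x0 {gx}.
have [/(_ gx) [d dE Ed] _] := E_letters u0.
have Edd : E d = d.
  by case: dE => [->|[v ->]]; [exact: E_zero | exact: E_Lv].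
have key S S' : factor S -> factor S' ->
    E (S * wprod scaled_letter x * S') = (\prod_(a <- x) a.1) *: E (S * d * S').
  move=> fS fS'; rewrite wprod_scaled bop_scaleAr bop_scaleAl E_scale ?Ed //.
  by apply: factor_between => //; exact: evaluable_letters.
exists (\prod_(a <- x) a.1), d; split=> //.
have -> : moment x = E (wprod scaled_letter x) by case: x x0 {gx u0 Ed key}.
by rewrite -[wprod _ x]mul1r -[1 * _]mulr1 key ?mul1r ?mulr1 ?Edd //; left.
Qed.

Lemma moment_wprod x : x != [::] -> moment x = E (wprod scaled_letter x).
Proof. by case: x. Qed.

Lemma moment_bad x : x != [::] -> ~~ goodx x -> moment x = 0.
Proof.
move=> x0 bx; have u0 : [seq a.2 | a <- x] != [::] by case: x x0 {bx}.
rewrite moment_wprod // wprod_scaled E_scale; last exact: evaluable_letters.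
by have [_ ->] := E_letters u0; rewrite ?scaler0.
Qed.

(** The bimodule property holds with L_v on both sides only; on the left, the word
provides its own left unit. *)
Lemma E_wprod_Lv x v : x != [::] ->
  E (wprod scaled_letter x) * Lv v = E (wprod scaled_letter x * Lv v).
Proof.
move=> x0; have px := evaluable_wprod x0; set W := wprod _ _ in px *.
have [v0 v0E] : exists v0, Lv v0 * W = W.
  case: x x0 @W px => // a x _ W _; exists (lsupp a.2); rewrite /W wprod_scaled.
  by rewrite bop_scaleAr Lv_letters.
have [v1 v1E] : exists v1, W * Lv v1 = W.
  case/lastP: x x0 @W px v0E => // x a _ W _ _; exists (lsupp (~~ a.2)).
  by rewrite /W wprod_scaled bop_scaleAl map_rcons letters_Lv.
have EW : Lv v0 * E W = E W.
  have h : E W = Lv v0 * E W * Lv v1 by rewrite -E_bimodule // v0E v1E.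
  by rewrite h !mulrA Lv_L eqxx.
by rewrite -[in LHS]EW -E_bimodule // v0E.
Qed.

Lemma cumulant_scaled n (a : 'I_n -> C * bool) :
  cumulant E (fun i => scaled_letter (a i)) =
  moment [seq a i | i <- enum 'I_n] *~
    \sum_(P | noncrossing P && good_part (fun i => (a i).2) good P)
       mobius (@nc_le n) P [set [set: 'I_n]]%SET.
Proof.
rewrite (cumulant_good goodx_ins (M := factor)).
- congr (_ *~ _); apply: eq_bigl => P; congr (_ && _).
  apply: eq_forallb => A; congr (_ ==> _); rewrite /goodx /block_word -map_comp //.
- by left.
- exact: factorM.
- by move=> b; right; apply: evaluableZ; exact: evaluable_letter.
- move=> x gx; have [->|x0] := eqVneq x [::]; first by left.
  have [c [d [-> dE _]]] := moment_good x0 gx; right; apply: evaluableZ.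
  by case: dE => [->|[v ->]]; [exact: evaluable0 | exact: evaluable_Lv].
- exact: E_zero.
- move=> S T x fS fT gx; have [->|x0] := eqVneq x [::].
    by rewrite /wprod big_nil.
  have [c [d [-> dE Ed]]] := moment_good x0 gx.
  rewrite Ed // bop_scaleAr bop_scaleAl E_scale //; apply: factor_between => //.
  by case: dE => [->|[v ->]]; [exact: evaluable0 | exact: evaluable_Lv].
- move=> x y x0 gy; have [->|y0] := eqVneq y [::]; first by rewrite mulr1 cats0.
  have [c [d [-> dE Ed]]] := moment_good y0 gy.
  have := Ed (wprod scaled_letter x) 1 (or_intror (evaluable_wprod x0)) (or_introl erefl).
  rewrite !mulr1 /wprod big_cat /= => ->; rewrite bop_scaleAr; congr (_ *: _).
  case: dE => [->|[v ->]]; first by rewrite !mulr0 E_zero.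
  exact: E_wprod_Lv.
- by move=> x x0 bx; rewrite -moment_wprod // moment_bad.
Qed.

Lemma Wstar_letter e : Wstar (letter e).
Proof. by apply: sub_wot_closure; case: (evaluable_letter e). Qed.

Lemma DG_letter (b : B) e : @DG R G b ->
  b * letter e = vcoef b (lsupp e) *: letter e.
Proof.
move=> /DG_diagonal bD; have -> : letter e = Lv (lsupp e) * letter e.
  by rewrite Lv_letter eqxx.
rewrite mulrA -bop_scaleAl; congr (_ * _); apply: bopP => f u.
rewrite bop_mulE bD bop_scaleE LvE; case: eqVneq => [->//|_]; by rewrite !mulr0.
Qed.

Lemma R_diagonal_letters :
  (forall n (eps : 'I_n -> bool), (0 < n)%N -> ~ alternating_even eps ->
     good [seq eps i | i <- enum 'I_n] ->
     \sum_(P | noncrossing P && good_part eps good P)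
        mobius (@nc_le n) P [set [set: 'I_n]]%SET = 0) ->
  R_diagonal (@Wstar R G) (@DG R G) E (L R w) (Lstar R w) /\
  R_diagonal (@Wstar R G) (@DG R G) E (Lstar R w) (L R w).
Proof.
move=> hsum.
have key n (eps : 'I_n -> bool) (b : 'I_n -> B) : (0 < n)%N ->
    (forall i, @DG R G (b i)) -> ~ alternating_even eps ->
    cumulant E (fun i => b i * letter (eps i)) = 0.
  move=> n0 bD nalt; pose a i := (vcoef (b i) (lsupp (eps i)), eps i).
  rewrite (_ : (fun i => _) = fun i => scaled_letter (a i)); last first.
    by apply: funext => i; rewrite DG_letter.
  rewrite cumulant_scaled; set x := [seq a i | i <- enum 'I_n].
  have xE : [seq b.2 | b <- x] = [seq eps i | i <- enum 'I_n] by rewrite -map_comp.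
  have [gx|bx] := boolP (goodx x).
    by rewrite hsum ?mulr0z //; rewrite -xE.
  rewrite [moment x](_ : _ = 0) ?mul0rz //.
  have x0 : x != [::] by rewrite -size_eq0 size_map size_enum_ord -lt0n.
  by rewrite moment_bad.
have WL : Wstar (L R w) := Wstar_letter true.
have WLs : Wstar (Lstar R w) := Wstar_letter false.
have diag1 : R_diagonal (@Wstar R G) (@DG R G) E (L R w) (Lstar R w).
  by apply: And3 WL WLs _ => n eps b n0 bD nalt; exact: key.
split; first exact: diag1.
apply: And3 WLs WL _ => n eps b n0 bD nalt.
transitivity (cumulant E (fun i => b i * letter (~~ eps i))).
  by congr (cumulant E _); apply: funext => i; case: (eps i).
apply: key => // -[en alt]; apply: nalt; split=> // i j ij.
by have := alt i j ij; case: (eps i); case: (eps j).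
Qed.

End Expectation.

(** * Words that are not alternating *)

Section CumulantSums.
Variables (n : nat) (eps : 'I_n -> bool).
Hypotheses (n0 : (0 < n)%N) (nalt : ~ alternating_even eps).
Let u := [seq eps i | i <- enum 'I_n].

Lemma nth_letters (i : 'I_n) : nth false u i = eps i.
Proof. by rewrite (nth_map i) ?size_enum_ord // nth_ord_enum. Qed.

Lemma sum_mobius_dyck_nonalternating : dyck 0 u ->
  \sum_(P | noncrossing P && good_part eps (dyck 0) P)
     mobius (@nc_le n) P [set [set: 'I_n]]%SET = 0.
Proof.
have su : size u = n by rewrite size_map size_enum_ord.
have nu : u != [::] by rewrite -size_eq0 su -lt0n.
case uE : u nu => [|[] u'] //= _ du.
have [u1 [u2 u12]] := peak (dyck_last (h := 0) (isT : false :: u' != [::]) du).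
rewrite -uE in u12.
have n2 : n = (size u1 + (size u2).+2)%N by rewrite -su u12 size_cat.
have i1 : (size u1 < n)%N by lia.
have i2 : ((size u1).+1 < n)%N by lia.
have e1 : eps (Ordinal i1) = false.
  by rewrite -nth_letters u12 nth_cat ltnn subnn.
have e2 : eps (Ordinal i2) = true.
  by rewrite -nth_letters u12 nth_cat /= ltnNge leqnSn /= subSnn.
have [n3|n3] := ltnP 2 n; first exact: (@sum_mobius_dyck n eps (Ordinal i1) (Ordinal i2)).
case: nalt; have n2' : n = 2%N by lia.
split=> [|i j ij]; first by rewrite n2'.
have -> : i = Ordinal i1 by apply: val_inj => /=; have := ltn_ord j; lia.
have -> : j = Ordinal i2 by apply: val_inj => /=; have := ltn_ord j; lia.
by rewrite e1 e2.
Qed.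

Lemma balanced_size (x : seq bool) : balanced x -> ~~ odd (size x).
Proof.
have : exists k : int, \sum_(e <- x) bracket e = (size x)%:Z - k *+ 2.
  elim: x => [|e x [k xk]]; first by exists 0; rewrite big_nil mul0rn.
  exists (if e then k else k + 1); rewrite big_cons xk /=.
  by case: e => /=; lia.
by rewrite /balanced => -[k ->]; lia.
Qed.

Lemma sum_mobius_balanced_nonalternating : balanced u ->
  \sum_(P | noncrossing P && good_part eps balanced P)
     mobius (@nc_le n) P [set [set: 'I_n]]%SET = 0.
Proof.
move=> /balanced_size; rewrite size_map size_enum_ord => en.
have [/existsP[g /existsP[g' /andP[/eqP gg' /eqP e]]]|noadj] := boolP
    [exists g : 'I_n, exists g' : 'I_n, (g' == g.+1 :> nat) && (eps g == eps g')].
  exact: (sum_mobius_balanced gg' e).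
case: nalt; split=> // i j ij; apply: contra noadj => /eqP e.
by apply/existsP; exists i; apply/existsP; exists j; rewrite ij eqxx e eqxx.
Qed.

End CumulantSums.

(** * R-diagonality for the two kinds of expectation *)

Section MainTheorem.
Variables (R : realType) (G : digraph) (w : fsgd G).
Hypothesis hw : is_path w.
Local Notation B := (bop R (fsgd G)).
Local Notation C := R[i].
Local Notation Lv v := (L R (vtx v)).
Local Notation letter := (letter R w).
Local Notation letters := (letters R w).
Implicit Types (S T : B) (e : bool) (u : seq bool) (v : vertex G).

Lemma vcoefZ c T v : vcoef (c *: T) v = c * vcoef T v.
Proof. by []. Qed.

Lemma EGE T f (u : fsgd G) : EG T f u = vcoef T (source u) * f u.
Proof. by []. Qed.

Lemma Lv_xi v v' : Lv v (xi (vtx v')) = if v' == v then xi (vtx v') else 0.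
Proof.
apply/val_inj/funext => u; rewrite -[LHS]/(Lv v (xi (vtx v')) u) LvE.
have [uv'|nu] := eqVneq u (vtx v').
  by rewrite uv' /=; case: ifP.
by rewrite /= (negbTE nu) /=; case: ifP => _; case: ifP => _ //=; rewrite (negbTE nu).
Qed.

Lemma vcoef_bimodule v v' T v0 :
  vcoef (Lv v * T * Lv v') v0 =
  if (v0 == v) && (v0 == v') then vcoef T v0 else 0.
Proof.
rewrite /vcoef !bop_mulE LvE Lv_xi /= [source _ == v]/=.
by case: (v0 == v) => //=; case: (v0 == v') => //=; rewrite bop_l2_zero.
Qed.

Lemma ldiv_path_vtx v : ldiv w (vtx v) = None.
Proof.
case hE : (ldiv w (vtx v)) => [h|] //; move/ldivP: hE => whv.
have [wh|wh] := eqVneq (target w) (source h); last by rewrite concat_none in whv.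
have [r [rE _ er _]] := concat_some wh; move: rE hw er; rewrite whv => -[<-].
by rewrite /is_path; case: (edges w).
Qed.

Lemma vcoef_letter_mul T v : vcoef (letter true * T) v = 0.
Proof. by rewrite /vcoef bop_mulE /= ldiv_path_vtx. Qed.

Lemma vcoef_mul_letter T v : vcoef (T * letter false) v = 0.
Proof. by rewrite /vcoef bop_mulE -[letter false]/(Lstar R w) Lstar_xi ldiv_path_vtx bop_l2_zero. Qed.

Lemma EG_eq0 T : (forall v, vcoef T v = 0) -> EG T = 0.
Proof. by move=> T0; apply: bopP => f u; rewrite EGE T0 mul0r. Qed.

Lemma cancels_false (E : B -> B) : cancels w E false.
Proof. by move=> S S' _ _; rewrite /= Lstar_L. Qed.

(** A word without factor L_w^* L_w begins with L_w or ends with L_w^* . Its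
coefficient at a vertex vanishes, because vertices are not in the range of L_w and
are annihilated by L_w^* . *)
Lemma vacuum_reduction u : u != [::] ->
  (exists u1 e u2, [/\ u = u1 ++ [:: e; ~~ e] ++ u2, dyck 0 [:: e; ~~ e] &
     cancels w (@EG R G) e])
  \/ ~~ dyck 0 u /\ EG (letters u) = 0.
Proof.
case: u => // -[] u _.
  right; split=> //; apply: EG_eq0 => v.
  by rewrite /letters big_cons vcoef_letter_mul.
have [/peak[u1 [u2 uE]]|] := boolP (last false (false :: u)).
  left; exists u1, false, u2; split=> //; exact: cancels_false.
case/lastP: u => [_|u e] /=.
  right; split=> //; apply: EG_eq0 => v.
  by rewrite /letters big_seq1 -[X in vcoef X]mul1r vcoef_mul_letter.
rewrite last_rcons => /negbTE ->; right; split.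
  by rewrite /= dyck_rcons_false.
apply: EG_eq0 => v; rewrite -[false :: _]/(rcons (false :: u) false) -cats1 letters_cat.
have -> : letters [:: false] = letter false by exact: big_seq1.
exact: vcoef_mul_letter.
Qed.

Lemma EG_R_diagonal :
  R_diagonal (@Wstar R G) (@DG R G) (@EG R G) (L R w) (Lstar R w) /\
  R_diagonal (@Wstar R G) (@DG R G) (@EG R G) (Lstar R w) (L R w).
Proof.
apply: (R_diagonal_letters dyck_insertion).
- by move=> c T _; apply: bopP => f u; rewrite bop_scaleE !EGE vcoefZ mulrA.
- move=> v v' T _; apply: bopP => f u; rewrite EGE vcoef_bimodule !bop_mulE LvE EGE LvE.
  by case: (_ == v); case: (_ == v'); rewrite ?mulr0 ?mul0r.
- move=> v; apply: bopP => f u; rewrite EGE vcoef_L LvE.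
  have -> : (vtx v == vtx (source u)) = (source u == v).
    by apply/eqP/eqP => [[]|->].
  by case: eqP => _; rewrite ?mul1r ?mul0r.
- exact: vacuum_reduction.
- by move=> n eps n0 nalt du; exact: sum_mobius_dyck_nonalternating.
Qed.

(** A power of L_w is 0 or the operator of a path, so that every expectation as in
graph_expectation vanishes on it. *)
Lemma path_power k :
  (exists2 p, is_path p & letters (nseq k.+1 true) = L R p /\
                          letters (nseq k.+1 false) = Lstar R p)
  \/ letters (nseq k.+1 true) = 0 /\ letters (nseq k.+1 false) = 0.
Proof.
elim: k => [|k IHk]; first by left; exists w => //; rewrite /letters !big_seq1.
have sT : letters (nseq k.+2 true) = L R w * letters (nseq k.+1 true).
  by rewrite /letters -[nseq k.+2 _]/(true :: nseq k.+1 true) big_cons.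
have sF : letters (nseq k.+2 false) = letters (nseq k.+1 false) * Lstar R w.
  rewrite /letters -addn1 nseqD big_cat; congr (_ * _).
  by rewrite big_seq1.
rewrite sT sF; case: IHk => [[p pp [-> ->]]|[-> ->]]; last first.
  by right; rewrite mulr0 mul0r.
rewrite L_mul Lstar_mul; have [wp|wp] := eqVneq (target w) (source p).
  have [r [-> _ er _]] := concat_some wp; left; exists r => //.
  by rewrite /is_path er; move: pp; rewrite /is_path; case: (edges w).
by rewrite concat_none //; right.
Qed.

Section RangeRule.
Variable E : B -> B.
Hypotheses (hE : graph_expectation E) (hr : range_rule w E).

Lemma evaluable_Wstar T : evaluable w T -> Wstar T.
Proof. by case=> pT _; apply: sub_wot_closure. Qed.

Lemma expectation_zero : E 0 = 0.
Proof.
have [[_ _ lin _] _] := hE; have W0 := evaluable_Wstar (evaluable0 R w).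
have := lin 1 _ _ W0 W0; rewrite !scale1r addr0 => /eqP.
by rewrite -subr_eq0 opprD addrA subrr sub0r oppr_eq0 => /eqP.
Qed.

(** The range rule applies between evaluable factors, and S or S' may be 1; so the
unit L_x of L_w L_w^* is inserted on both sides. *)
Lemma cancels_true : cancels w E true.
Proof.
move=> S S' fS fS'; pose V := Lv (source w).
have pV : evaluable w V by exact: evaluable_Lv.
have VV : V * V = V by rewrite Lv_L eqxx.
have pl : evaluable w (S * V).
  by rewrite -[S * V]mulr1; apply: factor_between => //; left.
have pr : evaluable w (V * S').
  by rewrite -[V * S']mul1r mulrA; apply: factor_between => //; left.
have := hr pl.2 pr.2; rewrite -/V.
have -> : S * V * (L R w * Lstar R w) * (V * S') = S * (letter true * letter (~~ true)) * S'.
  by rewrite !mulrA -[S * V * _]mulrA Lv_L eqxx -[S * _ * _ * V]mulrA Lstar_Lv eqxx.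
by have -> : S * V * V * (V * S') = S * V * S' by rewrite !mulrA -!(mulrA S V V) VV -(mulrA S V V) VV.
Qed.

(** Under the range rule any two adjacent different letters cancel; a word without
such letters is a power. *)
Lemma balanced_reduction u : u != [::] ->
  (exists u1 e u2, [/\ u = u1 ++ [:: e; ~~ e] ++ u2, balanced [:: e; ~~ e] &
     cancels w E e])
  \/ ~~ balanced u /\ E (letters u) = 0.
Proof.
case: u => // e u _.
have [[u1 [e' [u2 uE]]]|uE] : (exists u1 e' u2, e :: u = u1 ++ [:: e'; ~~ e'] ++ u2)
    \/ e :: u = nseq (size u).+1 e.
- elim: u e => [|e' u IHu] e; first by right.
  have [->|ne] := eqVneq e' e.
    case: (IHu e) => [[u1 [e1 [u2 uE]]]|uE]; last by right; rewrite {1}uE.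
    by left; exists (e :: u1), e1, u2; rewrite uE.
  by left; exists [::], e, u; case: e e' ne => [] [].
- left; exists u1, e', u2; split=> //.
    by rewrite /balanced big_cons big_seq1; case: e' {uE}.
  by case: e' {uE}; [exact: cancels_true | exact: cancels_false].
right; rewrite uE; split.
  rewrite /balanced (eq_big_seq (fun=> bracket e)); last by move=> e' /nseqP[->].
  rewrite big_const_seq count_predT size_nseq iter_addr_0 mulrn_eq0 /=.
  by case: e {uE}.
have [_ E0] := hE.
have [[p pp [pT pF]]|[pT pF]] := path_power (size u).
  by have [ET EF] := E0 p pp; case: e {uE}; rewrite ?pT ?pF.
by case: e {uE}; rewrite ?pT ?pF expectation_zero.
Qed.

Lemma E_R_diagonal :
  R_diagonal (@Wstar R G) (@DG R G) E (L R w) (Lstar R w) /\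
  R_diagonal (@Wstar R G) (@DG R G) E (Lstar R w) (L R w).
Proof.
have [[_ Eid lin bim] _] := hE.
have DLv v : DG (Lv v) by apply: sub_wot_closure; apply: Gen_in; exists v.
apply: (R_diagonal_letters balanced_insertion).
- move=> c T pT; have := lin c T 0 (evaluable_Wstar pT) (evaluable_Wstar (evaluable0 R w)).
  by rewrite expectation_zero !addr0.
- by move=> v v' T pT; apply: bim => //; exact: evaluable_Wstar.
- by move=> v; exact: Eid.
- exact: balanced_reduction.
- by move=> n eps n0 nalt bu; exact: sum_mobius_balanced_nonalternating.
Qed.

End RangeRule.
End MainTheorem.

Theorem theorem6p1 (R : realType) (G : digraph) (w : fsgd G) (hw : is_path w) :
  let W := @Wstar R G in
  let D := @DG R G in
  let x := @L R G w in
  let xs := @Lstar R G w in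
  (R_diagonal W D (@EG R G) x xs /\ R_diagonal W D (@EG R G) xs x) /\
  (forall E : bop R (fsgd G) -> bop R (fsgd G),
     graph_expectation E -> range_rule w E ->
     R_diagonal W D E x xs /\ R_diagonal W D E xs x).
Proof.
move=> W D x xs; split; first exact: EG_R_diagonal.
by move=> E hE hr; exact: E_R_diagonal.
Qed.
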